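(* Let $0\le j\le3$. The Nichols algebra associated with $\Bbbk_{\chi^j}=\Bbbk x$ is $$\mathfrak B(\Bbbk_{\chi^j})=\begin{cases}\Bbbk[x],&\text{for }j=0,2,\\ \Bbbk[x]/(x^2)=\bigwedge\Bbbk_{\chi^j},&\text{for }j=1,3.\end{cases}$$
   Context: $\Bbbk$ is an algebraically closed field of characteristic zero and $\xi\in\Bbbk$ is a fixed primitive $4$-th root of unity. $\mathcal K$ is the $8$-dimensional Hopf algebra over $\Bbbk$ generated as an algebra by $a,b,c,d$ with relations $ab=\xi ba$, $ac=\xi ca$, $cb=bc=0$, $cd=\xi dc$, $bd=\xi db$, $ad=da$, $ad=1$, $b^2=c^2=0$, $a^2c=b$, $a^4=1$, with $\Delta(a)=a\otimes a+b\otimes c$, $\Delta(b)=a\otimes b+b\otimes d$, $\Delta(c)=c\otimes a+d\otimes c$, $\Delta(d)=c\otimes b+d\otimes d$, $\varepsilon(a)=\varepsilon(d)=1$, $\varepsilon(b)=\varepsilon(c)=0$, $\mathcal S(a)=d$, $\mathcal S(b)=\xi b$, $\mathcal S(c)=-\xi c$, $\mathcal S(d)=a$. ${}^{\mathcal K}_{\mathcal K}\mathcal{YD}$ is the category of left Yetter-Drinfeld modules over $\mathcal K$: left modules and left comodules $M$ (coaction $\delta(m)=m_{(-1)}\otimes m_{(0)}$) with $\delta(h\cdot m)=h_{(1)}m_{(-1)}\mathcal S(h_{(3)})\otimes h_{(2)}\cdot m_{(0)}$; its braiding is $c_{M,N}(m\otimes n)=m_{(-1)}\cdot n\otimes m_{(0)}$.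 The Nichols algebra $\mathfrak B(V)$ is the (unique up to isomorphism) $\mathbb N$-graded braided Hopf algebra $R=\bigoplus_{n\ge0}R(n)$ in this category with $R(0)\simeq\Bbbk$, $R(1)\simeq V$, $R(1)$ equal to the space of primitive elements of $R$, and $R$ generated as an algebra by $R(1)$. For $0\le j\le3$, $\Bbbk_{\chi^j}=\Bbbk x\in{}^{\mathcal K}_{\mathcal K}\mathcal{YD}$ has action $a\cdot x=\xi^jx$, $b\cdot x=c\cdot x=0$, $d\cdot x=\xi^{-j}x$ and coaction $\delta(x)=a^{2j}\otimes x$. *)

(* Defs.v *)
From HB Require Import structures.
From mathcomp Require Import all_boot all_order all_algebra all_field.
From mathcomp Require Import generic_quotient boolp.

Set Implicit Arguments.
Unset Strict Implicit.
Unset Printing Implicit Defensive.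

Import GRing.Theory.
Local Open Scope ring_scope.
Local Open Scope quotient_scope.

(* MathComp has no tensor product of (possibly infinite-dimensional) vector   *)
(* spaces, so one is built here.  A formal sum of pure tensors is a list of   *)
(* pairs (v, w); two lists are identified when no bilinear map into any       *)
(* k-vector space separates them.  The universal property is given by         *)
(* [tpure_bilinear], [tlift_linear], [tlift_pure] and [tlift_unique].         *)

Section Tensor.
Variable k : fieldType.

Definition bilin (V W U : lmodType k) (f : V -> W -> U) : Prop :=
  (forall v, linear (f v)) /\ (forall w, linear (f^~ w)).

Section TensorProduct.
Variables V W : lmodType k.

Definition fsum (U : lmodType k) (f : V -> W -> U) (s : seq (V * W)) : U :=
  \sum_(p <- s) f p.1 p.2.

Definition tens_eq : rel (seq (V * W)) := fun s t =>
  `[< forall (U : lmodType k) (f : V -> W -> U),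
        bilin f -> fsum f s = fsum f t >].

Lemma tens_eq_equiv : equiv_class_of tens_eq.
Proof.
split=> [s|s t|t s u].
- by apply/asboolP.
- by apply/asboolP/asboolP => H U f bf; rewrite H.
- by move=> /asboolP H1 /asboolP H2; apply/asboolP => U f bf; rewrite H1 ?H2.
Qed.

Canonical tens_eq_rel := EquivRelPack tens_eq_equiv.

Definition tensor := {eq_quot tens_eq_rel}.

HB.instance Definition _ := Choice.on tensor.

(* The linear map induced by [f], meaningful only when [bilin f] holds. *)
Definition tlift (U : lmodType k) (f : V -> W -> U) (t : tensor) : U :=
  fsum f (repr t).

Let tpi (s : seq (V * W)) : tensor := \pi_tensor s.

Lemma tlift_pi (U : lmodType k) (f : V -> W -> U) s :
  bilin f -> tlift f (tpi s) = fsum f s.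
Proof.
move=> bf; rewrite /tlift /tpi.
have /eqmodP/asboolP H : repr (\pi_tensor s) = s %[mod tensor].
  by rewrite reprK.
exact: H.
Qed.

Lemma tens_ext (x y : tensor) :
  (forall (U : lmodType k) (f : V -> W -> U), bilin f -> tlift f x = tlift f y) ->
  x = y.
Proof.
move=> H; rewrite -[x]reprK -[y]reprK; apply/eqmodP/asboolP => U f bf.
exact: H.
Qed.

Definition tzero : tensor := tpi [::].
Definition tadd (x y : tensor) : tensor := tpi (repr x ++ repr y).
Definition tscale (a : k) (x : tensor) : tensor :=
  tpi [seq (a *: p.1, p.2) | p <- repr x].
Definition topp (x : tensor) : tensor := tscale (-1) x.

Lemma bilin0l (U : lmodType k) (f : V -> W -> U) w : bilin f -> f 0 w = 0.
Proof.
move=> [_ /(_ w) H]; have := H (-1) 0 0.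
by rewrite scaler0 addr0 scaleN1r addNr.
Qed.

Lemma bilinZl (U : lmodType k) (f : V -> W -> U) a v w :
  bilin f -> f (a *: v) w = a *: f v w.
Proof.
move=> bf; have [_ /(_ w) H] := bf; have := H a v 0.
by rewrite bilin0l // !addr0.
Qed.

Lemma tlift0 (U : lmodType k) (f : V -> W -> U) :
  bilin f -> tlift f tzero = 0.
Proof. by move=> bf; rewrite tlift_pi // /fsum big_nil. Qed.

Lemma tliftD (U : lmodType k) (f : V -> W -> U) x y :
  bilin f -> tlift f (tadd x y) = tlift f x + tlift f y.
Proof. by move=> bf; rewrite tlift_pi // /fsum big_cat. Qed.

Lemma tliftZ (U : lmodType k) (f : V -> W -> U) a x :
  bilin f -> tlift f (tscale a x) = a *: tlift f x.
Proof.
move=> bf; rewrite tlift_pi // /fsum big_map scaler_sumr.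
by apply: eq_bigr => p _ /=; rewrite bilinZl.
Qed.

Lemma taddA : associative tadd.
Proof. by move=> x y z; apply: tens_ext => U f bf; rewrite !tliftD // addrA. Qed.
Lemma taddC : commutative tadd.
Proof. by move=> x y; apply: tens_ext => U f bf; rewrite !tliftD // addrC. Qed.
Lemma tadd0 : left_id tzero tadd.
Proof.
by move=> x; apply: tens_ext => U f bf; rewrite tliftD // tlift0 // add0r.
Qed.
Lemma taddN : left_inverse tzero topp tadd.
Proof.
move=> x; apply: tens_ext => U f bf.
by rewrite tliftD // tliftZ // tlift0 // scaleN1r addNr.
Qed.

HB.instance Definition _ := GRing.isZmodule.Build tensor taddA taddC tadd0 taddN.

Lemma tscaleA a b x : tscale a (tscale b x) = tscale (a * b) x.
Proof. by apply: tens_ext => U f bf; rewrite !tliftZ // scalerA. Qed.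
Lemma tscale1 : left_id 1 tscale.
Proof. by move=> x; apply: tens_ext => U f bf; rewrite !tliftZ // scale1r. Qed.
Lemma tscaleDr : right_distributive tscale +%R.
Proof.
by move=> a x y; apply: tens_ext => U f bf; rewrite tliftZ // !tliftD // !tliftZ //
   scalerDr.
Qed.
Lemma tscaleDl x : {morph tscale^~ x : a b / a + b}.
Proof.
by move=> a b; apply: tens_ext => U f bf; rewrite tliftZ // tliftD // !tliftZ //
   scalerDl.
Qed.

HB.instance Definition _ :=
  GRing.Zmodule_isLmodule.Build k tensor tscaleA tscale1 tscaleDr tscaleDl.

Definition tpure (v : V) (w : W) : tensor := tpi [:: (v, w)].

Lemma tlift_pure (U : lmodType k) (f : V -> W -> U) v w :
  bilin f -> tlift f (tpure v w) = f v w.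
Proof. by move=> bf; rewrite tlift_pi // /fsum big_seq1. Qed.

Lemma tlift_linear (U : lmodType k) (f : V -> W -> U) :
  bilin f -> linear (tlift f).
Proof. by move=> bf a x y; rewrite tliftD // tliftZ. Qed.

Lemma tpure_bilinear : bilin tpure.
Proof.
split=> [v a w w'|w a v v']; apply: tens_ext => U f bf;
  rewrite tliftD // tliftZ // !tlift_pure //; [exact: bf.1 | exact: bf.2].
Qed.

Lemma tensE (t : tensor) : t = \sum_(p <- repr t) tpure p.1 p.2.
Proof.
apply: tens_ext => U f bf.
have Hl := tlift_linear bf.
rewrite {1}/tlift /fsum; elim: (repr t) => [|p s IH].
  by rewrite !big_nil tlift0.
by rewrite !big_cons IH tliftD // tlift_pure.
Qed.

Lemma tlift_unique (U : lmodType k) (g : tensor -> U) (f : V -> W -> U) :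
  linear g -> (forall v w, g (tpure v w) = f v w) -> g =1 tlift f.
Proof.
move=> lg gE t; rewrite [in LHS](tensE t) /tlift /fsum.
have g0 : g 0 = 0 by have := lg (-1) 0 0; rewrite scaler0 addr0 scaleN1r addNr.
elim: (repr t) => [|p s IH]; first by rewrite !big_nil.
by rewrite !big_cons -[tpure _ _]scale1r lg IH scale1r gE.
Qed.

(* The subspace spanned by the pure tensors v (x) w with P v w. *)
Definition tspan (P : V -> W -> Prop) (t : tensor) : Prop :=
  exists2 s : seq (V * W), (forall p, p \in s -> P p.1 p.2)
                         & t = \sum_(p <- s) tpure p.1 p.2.

End TensorProduct.

End Tensor.

Arguments tensor {k} (V W)%_type_scope.

Notation "V ⊗ W" := (tensor V W) (at level 40, left associativity) : type_scope.
Notation "v ⊗ w" := (tpure v w) (at level 40, left associativity) : ring_scope.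

Section Defs.
Variable k : fieldType.

Definition tmap (V W V' W' : lmodType k) (f : V -> V') (g : W -> W') :
  V ⊗ W -> V' ⊗ W' := tlift (fun v w => f v ⊗ g w).

Definition tassoc (U V W : lmodType k) : (U ⊗ V) ⊗ W -> U ⊗ (V ⊗ W) :=
  tlift (fun t w => tlift (fun u v => u ⊗ (v ⊗ w)) t).

Definition tmul (A B : algType k) (s t : A ⊗ B) : A ⊗ B :=
  tlift (fun x y => tlift (fun x' y' => (x * x') ⊗ (y * y')) t) s.

Definition is_coalgebra (C : lmodType k) (Delta : C -> C ⊗ C) (eps : C -> k^o) :
    Prop :=
  [/\ linear Delta, linear eps,
      forall x, tassoc (tmap Delta id (Delta x)) = tmap id Delta (Delta x),
      forall x, tlift (fun y z => eps y *: z) (Delta x) = x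
    & forall x, tlift (fun y z => eps z *: y) (Delta x) = x].

Definition is_antipode (A : algType k) (Delta : A -> A ⊗ A) (eps : A -> k^o)
    (S : A -> A) : Prop :=
  [/\ linear S,
      forall x, tlift (fun y z => S y * z) (Delta x) = (eps x)%:A
    & forall x, tlift (fun y z => y * S z) (Delta x) = (eps x)%:A].

Record hopf_data (H : algType k) := HopfData {
  comul : H -> H ⊗ H;
  counit : H -> k^o;
  antip : H -> H }.

Definition is_hopf (H : algType k) (D : hopf_data H) : Prop :=
  [/\ is_coalgebra (comul D) (counit D),
      comul D 1 = 1 ⊗ 1 /\
        (forall x y, comul D (x * y) = tmul (comul D x) (comul D y)),
      counit D 1 = 1 /\ (forall x y, counit D (x * y) = counit D x * counit D y)
    & is_antipode (comul D) (counit D) (antip D)].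

Section YetterDrinfeld.
Variables (H : algType k) (D : hopf_data H).

Record yd_data (M : lmodType k) := YDData {
  act : H -> M -> M;
  coact : M -> H ⊗ M }.

Arguments yd_data M%_type_scope.
Arguments YDData M%_type_scope.

Definition is_module (M : lmodType k) (Y : yd_data M) : Prop :=
  [/\ bilin (act Y), forall m, act Y 1 m = m
    & forall g h m, act Y (g * h) m = act Y g (act Y h m)].

Definition is_comodule (M : lmodType k) (Y : yd_data M) : Prop :=
  [/\ linear (coact Y),
      forall m, tassoc (tmap (comul D) id (coact Y m)) = tmap id (coact Y) (coact Y m)
    & forall m, tlift (fun h m0 => counit D h *: m0) (coact Y m) = m].

Definition is_yd (M : lmodType k) (Y : yd_data M) : Prop :=
  [/\ is_module Y, is_comodule Y
    & forall h m, coact Y (act Y h m) =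
        tlift (fun h12 h3 =>
          tlift (fun h1 h2 =>
            tlift (fun n m0 => (h1 * n * antip D h3) ⊗ act Y h2 m0) (coact Y m))
          h12) (tmap (comul D) id (comul D h))].

Definition yd_morph (M N : lmodType k) (YM : yd_data M) (YN : yd_data N)
    (f : M -> N) : Prop :=
  [/\ linear f, forall h m, f (act YM h m) = act YN h (f m)
    & forall m, coact YN (f m) = tmap id f (coact YM m)].

Definition yd_unit : yd_data k^o :=
  @YDData k^o (fun h t => counit D h *: t) (fun t => 1 ⊗ t).

Definition yd_tensor (M N : lmodType k) (YM : yd_data M) (YN : yd_data N) :
    yd_data (M ⊗ N) :=
  @YDData (M ⊗ N)
    (fun h t => tlift (fun h1 h2 => tmap (act YM h1) (act YN h2) t) (comul D h))
    (tlift (fun m n =>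
      tlift (fun g m0 => tlift (fun h n0 => (g * h) ⊗ (m0 ⊗ n0)) (coact YN n))
        (coact YM m))).

Definition braiding (M N : lmodType k) (YM : yd_data M) (YN : yd_data N) :
    M ⊗ N -> N ⊗ M :=
  tlift (fun m n => tlift (fun h m0 => act YN h n ⊗ m0) (coact YM m)).

Record braided_hopf_data (R : algType k) := BraidedHopfData {
  bh_yd :> yd_data R;
  bcomul : R -> R ⊗ R;
  bcounit : R -> k^o;
  bantip : R -> R }.

(* (mul (x) mul) o (id (x) c (x) id), the product of the braided tensor square *)
Definition bmul (R : algType k) (Y : yd_data R) (s t : R ⊗ R) : R ⊗ R :=
  tlift (fun x y =>
    tlift (fun x' y' =>
      tlift (fun p q => (x * p) ⊗ (q * y')) (braiding Y Y (y ⊗ x'))) t) s.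

Definition is_braided_hopf (R : algType k) (B : braided_hopf_data R) : Prop :=
  is_yd B /\
  [/\ yd_morph (yd_tensor B B) B (tlift (fun x y => x * y)),
      yd_morph yd_unit B (fun t : k^o => t%:A),
      yd_morph B (yd_tensor B B) (bcomul B),
      yd_morph B yd_unit (bcounit B)
    & yd_morph B B (bantip B)] /\
  [/\ is_coalgebra (bcomul B) (bcounit B),
      bcomul B 1 = 1 ⊗ 1 /\
        (forall x y, bcomul B (x * y) = bmul B (bcomul B x) (bcomul B y)),
      bcounit B 1 = 1 /\
        (forall x y, bcounit B (x * y) = bcounit B x * bcounit B y)
    & is_antipode (bcomul B) (bcounit B) (bantip B)].

(* gr n is the homogeneous component R(n) *)
Definition is_direct_decomposition (R : lmodType k) (gr : nat -> R -> Prop) :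
    Prop :=
  [/\ forall n, gr n 0,
      forall n t x y, gr n x -> gr n y -> gr n (t *: x + y),
      forall x, exists N (f : nat -> R),
        (forall n, gr n (f n)) /\ x = \sum_(n < N) f n
    & forall N (f : nat -> R), (forall n, gr n (f n)) -> \sum_(n < N) f n = 0 ->
        forall n, (n < N)%N -> f n = 0].

Definition is_graded_braided_hopf (R : algType k) (B : braided_hopf_data R)
    (gr : nat -> R -> Prop) : Prop :=
  is_braided_hopf B /\ is_direct_decomposition gr /\
  [/\ forall n h x, gr n x -> gr n (act B h x),
      forall n x, gr n x -> tspan (fun _ y => gr n y) (coact B x),
      gr 0 1
    & forall m n x y, gr m x -> gr n y -> gr (m + n)%N (x * y)] /\
  [/\ forall n x, gr n x ->
        tspan (fun y z => exists p q, [/\ (p + q)%N = n, gr p y & gr q z])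
              (bcomul B x),
      forall n x, (0 < n)%N -> gr n x -> bcounit B x = 0
    & forall n x, gr n x -> gr n (bantip B x)].

Definition yd_iso_onto (M N : lmodType k) (YM : yd_data M) (YN : yd_data N)
    (P : N -> Prop) (f : M -> N) : Prop :=
  [/\ yd_morph YM YN f, injective f & forall y, P y <-> exists m, y = f m].

Definition generates (A : algType k) (P : A -> Prop) : Prop :=
  forall Q : A -> Prop, (forall x, P x -> Q x) -> Q 1 ->
    (forall t x y, Q x -> Q y -> Q (t *: x + y)) ->
    (forall x y, Q x -> Q y -> Q (x * y)) -> forall x, Q x.

(* iota : V -> R is the identification of V with R(1) *)
Definition is_nichols (V : lmodType k) (Y : yd_data V) (R : algType k)
    (B : braided_hopf_data R) (gr : nat -> R -> Prop) (iota : V -> R) : Prop :=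
  [/\ is_graded_braided_hopf B gr,
      exists u : k^o -> R, yd_iso_onto yd_unit B (gr 0%N) u,
      yd_iso_onto Y B (gr 1%N) iota,
      forall x, gr 1%N x <-> bcomul B x = x ⊗ 1 + 1 ⊗ x
    & generates (gr 1%N)].

(* The algebra A, with V embedded by i, is the Nichols algebra of V: it       *)
(* carries the structure of one, and every Nichols algebra of V is isomorphic *)
(* to it as an algebra, compatibly with the embeddings of V.                  *)
Definition nichols_algebra_is (V : lmodType k) (Y : yd_data V) (A : algType k)
    (i : V -> A) : Prop :=
  (exists (B : braided_hopf_data A) gr, is_nichols Y B gr i) /\
  (forall (R : algType k) (B : braided_hopf_data R) gr (iota : V -> R),
     is_nichols Y B gr iota ->
     exists phi : {lrmorphism A -> R},
       bijective phi /\ forall v, phi (i v) = iota v).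

End YetterDrinfeld.

(* E, with i : V -> E, is the exterior algebra of V, i.e. universal among     *)
(* linear maps f from V to an algebra such that f(v)^2 = 0 for all v.         *)
Definition is_exterior_algebra (V : lmodType k) (E : algType k) (i : V -> E) :
    Prop :=
  [/\ linear i, forall v, i v ^+ 2 = 0
    & forall (A : algType k) (f : V -> A), linear f -> (forall v, f v ^+ 2 = 0) ->
      exists g : {lrmorphism E -> A}, (forall v, g (i v) = f v) /\
        forall g' : {lrmorphism E -> A}, (forall v, g' (i v) = f v) -> g' =1 g].

Section TheHopfAlgebraK.
Variable xi : k.

Definition K_relations (A : algType k) (a b c d : A) : Prop :=
  [/\ a * b = xi *: (b * a), a * c = xi *: (c * a), c * b = 0 & b * c = 0] /\
  [/\ c * d = xi *: (d * c), b * d = xi *: (d * b), a * d = d * a & a * d = 1] /\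
  [/\ b ^+ 2 = 0, c ^+ 2 = 0, a ^+ 2 * c = b & a ^+ 4 = 1].

Definition K_presentation (K : algType k) (a b c d : K) : Prop :=
  K_relations a b c d /\
  forall (A : algType k) (a' b' c' d' : A), K_relations a' b' c' d' ->
    exists f : {lrmorphism K -> A},
      [/\ f a = a', f b = b', f c = c' & f d = d'] /\
      forall g : {lrmorphism K -> A},
        [/\ g a = a', g b = b', g c = c' & g d = d'] -> g =1 f.

Definition is_K (K : falgType k) (D : hopf_data K) (a b c d : K) : Prop :=
  [/\ \dim {:K} = 8%N, K_presentation a b c d & is_hopf D] /\
  [/\ comul D a = a ⊗ a + b ⊗ c, comul D b = a ⊗ b + b ⊗ d,
      comul D c = c ⊗ a + d ⊗ c & comul D d = c ⊗ b + d ⊗ d] /\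
  [/\ counit D a = 1, counit D d = 1, counit D b = 0 & counit D c = 0] /\
  [/\ antip D a = d, antip D b = xi *: b, antip D c = - xi *: c & antip D d = a].

(* V = k x is the one-dimensional Yetter-Drinfeld module attached to chi^j *)
Definition is_k_chi (K : falgType k) (D : hopf_data K) (a b c d : K) (j : nat)
    (V : lmodType k) (Y : yd_data K V) (x : V) : Prop :=
  [/\ is_yd D Y, x != 0 & forall v, exists t, v = t *: x] /\
  [/\ act Y a x = xi ^+ j *: x, act Y b x = 0, act Y c x = 0
    & act Y d x = xi ^- j *: x] /\
  coact Y x = (a ^+ (2 * j)) ⊗ x.

End TheHopfAlgebraK.
End Defs.

(* Main.v *)
Require Import Defs.
From mathcomp Require Import all_boot all_order all_algebra all_field.
From mathcomp Require Import boolp.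
From HB Require Import structures.
Set Implicit Arguments.
Unset Strict Implicit.
Unset Printing Implicit Defensive.
Import GRing.Theory.
Local Open Scope ring_scope.

(** The statement is an instance of the computation of the Nichols algebra of
    a one-dimensional Yetter-Drinfeld module V = k x over a Hopf algebra H.
    There h x = chi(h) x for a character chi, the coaction is x |-> g (x) x for
    a grouplike g, and the braiding is c(x (x) x) = q x (x) x with q = chi(g).
    Here g = a^(2j) and chi(a) = xi^j, so q = xi^(2j^2), which is 1 for j even
    and -1 for j odd.

    Existence.  Let A be k[X] if q = 1 and k[X]/(X^2) if q = -1.  Let H act on
    X^n by the n-th convolution power of chi, coact by g^n, and let X be
    primitive.  With sigma(X^n) = q^n X^n, multiplicativity of the coproduct
    forces Delta(X r) = Theta(Delta r), where
      Theta(u (x) v) = X u (x) v + sigma(u) (x) X v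
    is left multiplication by Delta(X) in the braided tensor square.  So Delta
    is defined by Delta(X^n) = Theta^n(1 (x) 1), which is legitimate because
    Theta^2(1 (x) 1) = (1 + q) X (x) X vanishes when X^2 = 0 and q = -1.  Every
    axiom is then an induction on powers of X in which Theta commutes with the
    maps involved ([Theta_bmul], [line_coassoc], [line_is_antipode]), which
    avoids expanding Delta(X^n) with quantum binomial coefficients.

    Primitive elements.  If lambda is the coefficient of X, the map
    d = (lambda (x) id) Delta is a skew derivation, d(X r) = r + q X d(r), so
    d(X^(n+1)) = (n+1)_q X^n with (n)_q = 1 + q + ... + q^(n-1)
    ([skew_derX]).  As (n)_q <> 0 whenever X^n <> 0, n > 0, a primitive element
    has degree one ([primitive_degree1]).

    Uniqueness.  In any Nichols algebra of V, let y be the image of x.  The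
    powers of y span, and the grading makes every linear relation between
    them homogeneous, so the algebra is determined by the set of n with
    y^n = 0.  If q = 1, the same skew derivation and characteristic zero show
    by induction that no power vanishes ([nichols_pow_neq0]); if q = -1, then
    y^2 is primitive of degree two, hence zero ([nichols_sq0]). *)

(** * Linear maps and tensors *)

Section LinearMaps.
Variable k : fieldType.
Implicit Types U V W : lmodType k.

Lemma lin0 V U (f : V -> U) : linear f -> f 0 = 0.
Proof.
by move=> lf; have := lf (-1) 0 0; rewrite scaler0 addr0 scaleN1r addNr.
Qed.

Lemma linD V U (f : V -> U) : linear f -> {morph f : u v / u + v}.
Proof. by move=> lf u v; have := lf 1 u v; rewrite !scale1r. Qed.

Lemma linZ V U (f : V -> U) : linear f -> forall t u, f (t *: u) = t *: f u.
Proof. by move=> lf t u; have := lf t u 0; rewrite (lin0 lf) !addr0. Qed.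

Lemma linN V U (f : V -> U) : linear f -> {morph f : u / - u}.
Proof. by move=> lf u; rewrite -scaleN1r (linZ lf) scaleN1r. Qed.

Lemma lin_sum V U (f : V -> U) : linear f ->
  forall I (s : seq I) (F : I -> V), f (\sum_(i <- s) F i) = \sum_(i <- s) f (F i).
Proof.
by move=> lf I s F; rewrite (big_morph f (linD lf) (lin0 lf)).
Qed.

Lemma linear_id V : linear (fun v : V => v). Proof. by []. Qed.

Lemma linear_comp V W U (f : W -> U) (g : V -> W) :
  linear f -> linear g -> linear (fun v => f (g v)).
Proof. by move=> lf lg t u v; rewrite lg lf. Qed.

Lemma linear_add V U (f g : V -> U) :
  linear f -> linear g -> linear (fun v => f v + g v).
Proof. by move=> lf lg t u v; rewrite lf lg scalerDr addrACA. Qed.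

Lemma linear_scale V U (c : k) (f : V -> U) :
  linear f -> linear (fun v => c *: f v).
Proof. by move=> lf t u v; rewrite lf scalerDr !scalerA mulrC. Qed.

Lemma linear_scalel V U (f : V -> k^o) (w : U) :
  linear f -> linear (fun v => (f v : k) *: w).
Proof. by move=> lf t u v; rewrite lf scalerDl scalerA. Qed.

Lemma linear_mull V (A : algType k) (f : V -> A) (c : A) :
  linear f -> linear (fun v => f v * c).
Proof. by move=> lf t u v; rewrite lf mulrDl scalerAl. Qed.

Lemma linear_mulr V (A : algType k) (f : V -> A) (c : A) :
  linear f -> linear (fun v => c * f v).
Proof. by move=> lf t u v; rewrite lf mulrDr scalerAr. Qed.

(* [scalerAl] and [scalerAr] with the module structure reached directly from *)
(* the algebra, so that rewriting leaves instances in their usual form. *)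
Lemma algZMl (A : algType k) (t : k) (x y : A) : (t *: x) * y = t *: (x * y).
Proof. exact: esym (scalerAl t x y). Qed.

Lemma algZMr (A : algType k) (t : k) (x y : A) : x * (t *: y) = t *: (x * y).
Proof. exact: esym (scalerAr t x y). Qed.

Lemma linear_tpurel V W U (f : V -> W) (w : U) :
  linear f -> linear (fun v => f v ⊗ w).
Proof. by move=> lf t u v; rewrite lf; exact: (tpure_bilinear W U).2. Qed.

Lemma linear_tpurer V W U (f : V -> W) (w : U) :
  linear f -> linear (fun v => w ⊗ f v).
Proof. by move=> lf t u v; rewrite lf; exact: (tpure_bilinear U W).1. Qed.

Lemma tpure0l V W (w : W) : (0 : V) ⊗ w = 0.
Proof. exact: lin0 (linear_tpurel w (@linear_id V)). Qed.

Lemma tpure0r V W (v : V) : v ⊗ (0 : W) = 0.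
Proof. exact: lin0 (linear_tpurer v (@linear_id W)). Qed.

Lemma tpureNl V W (v : V) (w : W) : (- v) ⊗ w = - (v ⊗ w).
Proof. exact: (linN (linear_tpurel w (@linear_id V))). Qed.

Lemma tpureDr V W (v : V) (w w' : W) : v ⊗ (w + w') = v ⊗ w + v ⊗ w'.
Proof. exact: (linD (linear_tpurer v (@linear_id W))). Qed.

Lemma tpureZl V W (t : k) (v : V) (w : W) : (t *: v) ⊗ w = t *: (v ⊗ w).
Proof. exact: (linZ (linear_tpurel w (@linear_id V))). Qed.

Lemma tpureZr V W (t : k) (v : V) (w : W) : v ⊗ (t *: w) = t *: (v ⊗ w).
Proof. exact: (linZ (linear_tpurer v (@linear_id W))). Qed.

Lemma linear_tlift V (A B U : lmodType k) (f : A -> B -> U) (g : V -> A ⊗ B) :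
  bilin f -> linear g -> linear (fun v => tlift f (g v)).
Proof. by move=> bf lg t u v; rewrite lg (tlift_linear bf). Qed.

Lemma linear_tliftl V (A B U : lmodType k) (F : V -> A -> B -> U) t :
  (forall p q, linear (fun v => F v p q)) -> linear (fun v => tlift (F v) t).
Proof.
move=> lF c u v; rewrite /tlift /fsum scaler_sumr -big_split /=.
by apply: eq_bigr => p _; rewrite lF.
Qed.

Lemma eq_tlift (A B U : lmodType k) (f g : A -> B -> U) t :
  (forall p q, f p q = g p q) -> tlift f t = tlift g t.
Proof. by move=> e; apply: eq_bigr => p _; rewrite e. Qed.

(* Both sides are the same sum over any representative of the tensor. *)
Lemma lin_tlift (A B U W : lmodType k) (L : U -> W) (f : A -> B -> U) t :
  linear L -> L (tlift f t) = tlift (fun p q => L (f p q)) t.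
Proof. by move=> lL; rewrite /tlift /fsum lin_sum. Qed.

Lemma tlift_tmap (A B A' B' U : lmodType k) (f : A' -> B' -> U)
    (g : A -> A') (h : B -> B') t :
  bilin f -> tlift f (tmap g h t) = tlift (fun p q => f (g p) (h q)) t.
Proof.
move=> bf; rewrite /tmap lin_tlift; last exact: tlift_linear.
by apply: eq_tlift => p q; rewrite tlift_pure.
Qed.

Lemma tens_linear_ext (A B U : lmodType k) (f g : A ⊗ B -> U) :
  linear f -> linear g -> (forall p q, f (p ⊗ q) = g (p ⊗ q)) -> f =1 g.
Proof.
move=> lf lg e t; rewrite [t]tensE !lin_sum //.
by apply: eq_bigr => p _; rewrite e.
Qed.

Lemma tlift_tpure (A B : lmodType k) (t : A ⊗ B) : tlift (@tpure k A B) t = t.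
Proof. by rewrite [RHS]tensE. Qed.

End LinearMaps.

(** The linearity and bilinearity side conditions are syntactic: [lin] descends
    through tensors, products, scalings and induced maps until it meets maps
    that are linear by hypothesis. *)
Ltac lin_known :=
  first
  [ assumption
  | match goal with
    | H : bilin ?f |- _ => first [exact (proj1 H _) | exact (proj2 H _)]
    | H : forall _, GRing.linear_for _ _ |- _ => exact (H _)
    | H : forall _ _, GRing.linear_for _ _ |- _ => exact (H _ _)
    end
  | exact: linear_id ].
Ltac lin_step :=
  first
  [ lin_known
  | match goal with
    | |- bilin _ => split; intro
    | |- forall _ : _, _ => intro
    end
  | apply: linear_tpurel
  | apply: linear_tpurer
  | apply: linear_tlift
  | apply: linear_tliftl
  | apply: linear_add
  | apply: linear_scale
  | apply: linear_scalel
  | apply: linear_mull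
  | apply: linear_mulr
  | (apply: linear_comp; [solve [lin_known] | ]) ].
Ltac lin := solve [rewrite /tmap /tassoc; repeat (lin_step; cbv beta)].

(** * Sweedler calculus and characters of a Hopf algebra *)

Section Coalgebra.
Variable k : fieldType.
Variables (C : lmodType k) (Delta : C -> C ⊗ C) (eps : C -> k^o).
Hypothesis hC : is_coalgebra Delta eps.

(** Sweedler's notation: both sides are the sum of F(c_(1), c_(2), c_(3)). *)
Lemma coassoc_tlift (U : lmodType k) (F : C -> C -> C -> U) (c : C) :
  (forall x y, linear (F x y)) -> (forall x z, linear (fun y => F x y z)) ->
  (forall y z, linear (fun x => F x y z)) ->
  tlift (fun p z => tlift (fun x y => F x y z) (Delta p)) (Delta c) =
  tlift (fun x p => tlift (fun y z => F x y z) (Delta p)) (Delta c).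
Proof.
move=> l3 l2 l1; have [lD _ e _ _] := hC.
have bG : bilin (fun x t => tlift (fun y z => F x y z) t) by lin.
have := congr1 (tlift (fun x t => tlift (fun y z => F x y z) t)) (e c).
rewrite tlift_tmap // => <-.
transitivity (tlift (fun p z => tlift (fun x t => tlift (F x) t)
                                  (tassoc (p ⊗ z))) (tmap Delta id (Delta c))).
  rewrite tlift_tmap; last by lin.
  apply: eq_tlift => p z; rewrite [tassoc _]tlift_pure; last by lin.
  rewrite lin_tlift; last by lin.
  by apply: eq_tlift => x y; rewrite !tlift_pure //; lin.
rewrite -(lin_tlift (L := fun t => tlift _ (tassoc t))); last by lin.
by rewrite tlift_tpure.
Qed.

Lemma counitl_tlift (U : lmodType k) (f : C -> U) (c : C) : linear f ->
  tlift (fun x y => (eps x : k) *: f y) (Delta c) = f c.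
Proof.
move=> lf; have [_ le _ e _] := hC; rewrite -[in RHS](e c) (lin_tlift _ _ lf).
by apply: eq_tlift => p q; rewrite (linZ lf).
Qed.

Lemma counitr_tlift (U : lmodType k) (f : C -> U) (c : C) : linear f ->
  tlift (fun x y => (eps y : k) *: f x) (Delta c) = f c.
Proof.
move=> lf; have [_ le _ _ e] := hC; rewrite -[in RHS](e c) (lin_tlift _ _ lf).
by apply: eq_tlift => p q; rewrite (linZ lf).
Qed.

End Coalgebra.

Section Characters.
Variable k : fieldType.
Variables (H : algType k) (D : hopf_data H).
Hypothesis hD : is_hopf D.
Local Notation Delta := (comul D).
Local Notation eps := (counit D).
Local Notation S := (antip D).

Definition character (chi : H -> k^o) : Prop :=
  [/\ linear chi, chi 1 = 1 & forall g h, chi (g * h) = chi g * chi h].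

Definition grouplike (g : H) : Prop := Delta g = g ⊗ g /\ eps g = 1.

Definition conv (chi psi : H -> k^o) (h : H) : k^o :=
  tlift (fun x y => chi x * psi y) (Delta h).

Definition conv_pow (chi : H -> k^o) (n : nat) : H -> k^o :=
  iter n (conv chi) eps.

Let hDC : is_coalgebra Delta eps. Proof. by case: hD. Qed.
Let lDelta : linear Delta. Proof. by case: hDC. Qed.
Let leps : linear eps. Proof. by case: hDC. Qed.
Let lS : linear S. Proof. by case: hD => _ _ _ []. Qed.

Lemma character_counit : character eps.
Proof. by case: hD => _ _ [e1 eM] _; split. Qed.

Lemma conv_linear chi psi : linear chi -> linear psi -> linear (conv chi psi).
Proof. by move=> l1 l2; rewrite /conv; lin. Qed.

Lemma character_conv chi psi :
  character chi -> character psi -> character (conv chi psi).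
Proof.
move=> [l1 u1 m1] [l2 u2 m2]; case: hD => _ [D1 DM] _ _.
have bF : bilin (fun x y => chi x * psi y) by lin.
split; first exact: conv_linear.
  by rewrite /conv D1 tlift_pure // u1 u2 mulr1.
move=> g h; rewrite /conv DM.
move: (Delta h) => t; move: (Delta g) => s.
rewrite /tmul (lin_tlift _ _ (tlift_linear bF)).
set c := tlift _ t; rewrite (lin_tlift (L := fun v : k^o => v * c)); last by lin.
apply: eq_tlift => x y; rewrite /c.
rewrite (lin_tlift _ _ (tlift_linear bF)).
rewrite (lin_tlift (L := fun v : k^o => _ * v)); last by lin.
apply: eq_tlift => x' y'; rewrite tlift_pure // m1 m2.
by rewrite -!mulrA; congr (_ * _); rewrite !mulrA [psi y * _]mulrC.
Qed.

Lemma character_conv_pow chi n : character chi -> character (conv_pow chi n).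
Proof.
by move=> hc; elim: n => [|n IH]; [exact: character_counit | exact: character_conv].
Qed.

Lemma conv_powD chi m n h : linear chi ->
  conv_pow chi (m + n) h = conv (conv_pow chi m) (conv_pow chi n) h.
Proof.
move=> lc.
have lp i : linear (conv_pow chi i) by elim: i => //= i IH; exact: conv_linear.
have l0 := lp n.
elim: m h => [|m IH] h; rewrite /conv.
  by rewrite -[LHS](counitl_tlift hDC _ (lp n)).
have l1 := lp m.
rewrite addSn /= {1}/conv.
transitivity (tlift (fun x y => tlift (fun y z =>
    chi x * (conv_pow chi m y * conv_pow chi n z)) (Delta y)) (Delta h)).
  apply: eq_tlift => x y; rewrite IH /conv.
  by rewrite (lin_tlift (L := fun v : k^o => chi x * v)) //; lin.
rewrite -(coassoc_tlift hDC); try lin.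
apply: eq_tlift => x y.
rewrite [conv chi _ x]/conv.
rewrite (lin_tlift (L := fun v : k^o => v * conv_pow chi n y)); last by lin.
by apply: eq_tlift => p q; rewrite mulrA.
Qed.

Lemma conv_pow1 chi h : linear chi -> conv_pow chi 1 h = chi h.
Proof.
move=> lc; rewrite -[RHS](counitr_tlift (U := k^o) hDC h lc).
by apply: eq_tlift => u v; exact: mulrC.
Qed.

Lemma grouplikeX g n : grouplike g -> grouplike (g ^+ n).
Proof.
move=> [Dg eg]; case: hD => _ [D1 DM] [e1 eM] _.
elim: n => [|n [IH1 IH2]]; first by rewrite expr0.
split; last by rewrite exprS eM eg IH2 mulr1.
rewrite exprS DM Dg IH1 /tmul !tlift_pure //; lin.
Qed.

Lemma conv_pow_grouplike chi g n m : character chi -> grouplike g ->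
  conv_pow chi n (g ^+ m) = chi g ^+ (m * n).
Proof.
move=> hc hg; have [lc c1 cM] := hc.
elim: n => [|n IH]; first by rewrite muln0 [LHS](grouplikeX m hg).2.
have [lp _ _] := character_conv_pow n hc.
rewrite /= /conv (grouplikeX m hg).1 tlift_pure; last by lin.
rewrite IH mulnS exprD; congr (_ * _).
by elim: m {IH} => [|m IH]; rewrite ?expr0 // !exprS cM IH.
Qed.

(** The Yetter-Drinfeld compatibility of a line on which H acts by chi and
    coacts by g, cleared of the antipode: h_(1) chi(h_(2)) g equals
    chi(h_(1)) g h_(2).  In this form it is visibly stable under convolution
    of characters and product of grouplikes. *)
Definition yd_pair (chi : H -> k^o) (g : H) : Prop := forall h,
  tlift (fun x y => (chi y : k) *: (x * g)) (Delta h) =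
  tlift (fun x y => (chi x : k) *: (g * y)) (Delta h).

Lemma yd_pair_counit : yd_pair eps 1.
Proof.
move=> h; rewrite (counitr_tlift hDC) ?(counitl_tlift hDC) ?mulr1 ?mul1r //; lin.
Qed.

Lemma yd_pair_conv chi psi f g : linear chi -> linear psi ->
  yd_pair chi f -> yd_pair psi g -> yd_pair (conv chi psi) (f * g).
Proof.
move=> lc lp Hf Hg h.
transitivity (tlift (fun x y => tlift (fun y z => (chi y * psi z : k) *: (x * (f * g)))
                 (Delta y)) (Delta h)).
  apply: eq_tlift => x y; rewrite /conv.
  by rewrite (lin_tlift (L := fun v : k^o => (v : k) *: (x * (f * g)))) //; lin.
rewrite -(coassoc_tlift hDC); try lin.
transitivity (tlift (fun p z => (psi z : k) *:
    (tlift (fun x y => (chi x : k) *: (f * y)) (Delta p) * g)) (Delta h)).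
  apply: eq_tlift => p z; rewrite -Hf.
  rewrite (lin_tlift (L := fun v => (psi z : k) *: (v * g))); last by lin.
  by apply: eq_tlift => x y; rewrite algZMl scalerA mulrC mulrA.
transitivity (tlift (fun x p => (chi x : k) *:
    (f * tlift (fun x y => (psi y : k) *: (x * g)) (Delta p))) (Delta h)).
  transitivity (tlift (fun p z => tlift (fun x y => (psi z * chi x : k) *: (f * y * g))
                 (Delta p)) (Delta h)).
    apply: eq_tlift => p z.
    rewrite (lin_tlift (L := fun v => (psi z : k) *: (v * g))); last by lin.
    by apply: eq_tlift => x y; rewrite algZMl scalerA.
  rewrite (coassoc_tlift hDC
    (F := fun x y z => (psi z * chi x : k) *: (f * y * g))); try lin.
  apply: eq_tlift => x p.
  rewrite (lin_tlift (L := fun v => (chi x : k) *: (f * v))); last by lin.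
  by apply: eq_tlift => y z; rewrite algZMr scalerA mulrC mulrA.
transitivity (tlift (fun x p => tlift (fun y z => (chi x * psi y : k) *: (f * g * z))
                 (Delta p)) (Delta h)).
  apply: eq_tlift => x p; rewrite Hg.
  rewrite (lin_tlift (L := fun v => (chi x : k) *: (f * v))); last by lin.
  by apply: eq_tlift => y z; rewrite algZMr scalerA mulrA.
rewrite -(coassoc_tlift hDC); try lin.
apply: eq_tlift => p z; rewrite /conv.
by rewrite (lin_tlift (L := fun v : k^o => (v : k) *: (f * g * z))) //; lin.
Qed.

Lemma yd_pair_pow chi g n : character chi -> yd_pair chi g ->
  yd_pair (conv_pow chi n) (g ^+ n).
Proof.
move=> hc hg; elim: n => [|n IH]; first exact: yd_pair_counit.
have [lc _ _] := hc; have [lp _ _] := character_conv_pow n hc.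
by rewrite exprS; exact: yd_pair_conv.
Qed.

(** Multiplying h_(1) chi(h_(2)) g = chi(h_(1)) g h_(2) on the right by the
    antipode of the last Sweedler component gives back the compatibility in
    the form that defines Yetter-Drinfeld modules. *)
Lemma yd_pair_coact chi g h : linear chi -> yd_pair chi g ->
  tlift (fun p z => tlift (fun x y => (chi y : k) *: (x * g * S z)) (Delta p))
    (Delta h) = (chi h : k) *: g.
Proof.
move=> lc Hg; case: hD => _ _ _ [_ _ HS].
transitivity (tlift (fun p z => tlift (fun x y => (chi x : k) *: (g * y)) (Delta p)
                       * S z) (Delta h)).
  apply: eq_tlift => p z; rewrite -Hg.
  rewrite (lin_tlift (L := fun v => v * S z)); last by lin.
  by apply: eq_tlift => x y; rewrite algZMl.
transitivity (tlift (fun p z => tlift (fun x y => (chi x : k) *: (g * y * S z)) (Delta p))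
     (Delta h)).
  apply: eq_tlift => p z; rewrite (lin_tlift (L := fun v => v * S z)); last by lin.
  by apply: eq_tlift => x y; rewrite algZMl.
rewrite (coassoc_tlift hDC (F := fun x y z => (chi x : k) *: (g * y * S z))); try lin.
rewrite -(counitr_tlift hDC (f := fun x => (chi x : k) *: g)); last by lin.
apply: eq_tlift => x p.
transitivity ((chi x : k) *: (g * tlift (fun y z => y * S z) (Delta p))).
  rewrite (lin_tlift (L := fun v => (chi x : k) *: (g * v))); last by lin.
  by apply: eq_tlift => y z; rewrite mulrA.
by rewrite HS algZMr mulr1 !scalerA mulrC.
Qed.

(** The converse of [yd_pair_coact]: multiply on the right by one more Sweedler
    component, which cancels the antipode. *)
Lemma coact_yd_pair (chi : H -> k^o) (g : H) : linear chi ->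
  (forall h, tlift (fun p z => tlift (fun x y => (chi y : k) *: (x * g * S z))
     (Delta p)) (Delta h) = (chi h : k) *: g) -> yd_pair chi g.
Proof.
move=> lc Hg h; case: hD => _ _ _ [_ HS _].
pose T p := tlift (fun x y => (chi y : k) *: (x * g)) (Delta p).
have lT : linear T by rewrite /T; lin.
transitivity (tlift (fun q w => tlift (fun p z =>
    tlift (fun x y => (chi y : k) *: (x * g * S z)) (Delta p)) (Delta q) * w)
    (Delta h)); last first.
  by apply: eq_tlift => x y; rewrite Hg algZMl.
transitivity (tlift (fun p r => T p * tlift (fun z w => S z * w) (Delta r)) (Delta h)).
  rewrite -[LHS](counitr_tlift hDC (f := T)) //.
  by apply: eq_tlift => p r; rewrite HS algZMr mulr1.
transitivity (tlift (fun p r => tlift (fun z w => T p * (S z * w)) (Delta r)) (Delta h)).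
  by apply: eq_tlift => p r; rewrite (lin_tlift (L := fun v => _ * v)) //; lin.
rewrite -(coassoc_tlift hDC (F := fun p z w => T p * (S z * w))); try lin.
apply: eq_tlift => q w.
rewrite (lin_tlift (L := fun v => v * w)); last by lin.
apply: eq_tlift => p z; rewrite mulrA /T.
rewrite (lin_tlift (L := fun v => v * w)); last by lin.
rewrite (lin_tlift (L := fun v => v * S z * w)); last by lin.
by apply: eq_tlift => x y; rewrite !algZMl.
Qed.

End Characters.

(** * Algebras generated by one element with homogeneous relations *)

Section PolyCombination.
Variables (k : fieldType) (U : lmodType k).

Definition pcomb (f : nat -> U) (p : {poly k}) : U := \sum_(i < size p) p`_i *: f i.

Lemma pcomb_widen f (p : {poly k}) n : (size p <= n)%N ->
  pcomb f p = \sum_(i < n) p`_i *: f i.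
Proof.
move=> le; rewrite /pcomb (big_ord_widen n (fun i => p`_i *: f i) le) big_mkcond.
apply: eq_bigr => i _; case: ltnP => // lei.
by rewrite nth_default // scale0r.
Qed.

Lemma pcomb_linear f : linear (pcomb f).
Proof.
move=> t p q; set n := maxn (size (t *: p + q)) (maxn (size p) (size q)).
rewrite !(@pcomb_widen f _ n) ?leq_max ?leqnn ?orbT //.
rewrite scaler_sumr -big_split /=; apply: eq_bigr => i _.
by rewrite coefD coefZ scalerDl scalerA.
Qed.

Lemma pcombXn f n : pcomb f 'X^n = f n.
Proof.
rewrite (@pcomb_widen f _ n.+1) ?size_polyXn // (bigD1 ord_max) //=.
rewrite coefXn eqxx scale1r big1 ?addr0 // => i ne.
by rewrite coefXn (_ : (i == n :> nat) = false) ?scale0r //; apply/negbTE.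
Qed.

Lemma pcomb_delta f n p : pcomb (fun i => (i == n)%:R *: f i) p = p`_n *: f n.
Proof.
rewrite (@pcomb_widen _ _ (maxn (size p) n.+1)) ?leq_maxl //.
have ltn : (n < maxn (size p) n.+1)%N by rewrite leq_max ltnSn orbT.
rewrite (bigD1 (Ordinal ltn)) //= eqxx scale1r big1 ?addr0 // => i ne.
by rewrite (_ : (i == n :> nat) = false) ?scale0r ?scaler0 //; exact/negbTE.
Qed.

End PolyCombination.

Lemma poly_pow_sum (k : fieldType) (p : {poly k}) : p = pcomb (fun i => 'X^i) p.
Proof. by rewrite /pcomb -poly_def coefK. Qed.

(** Equivalently, A is k[X] modulo an ideal generated by monomials.  This
    covers k[X] and k[X]/(X^2), and also an arbitrary Nichols algebra of a
    line, before anything is known about which powers vanish. *)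
Definition graded_generator (k : fieldType) (A : algType k) (X : A) : Prop :=
  (forall r, exists p : {poly k}, r = pcomb (fun i => X ^+ i) p) /\
  (forall p : {poly k}, pcomb (fun i => X ^+ i) p = 0 -> forall i, p`_i *: X ^+ i = 0).

Section GradedGenerator.
Variables (k : fieldType) (A : algType k) (X : A).
Hypothesis hX : graded_generator X.

Lemma pow_ind (P : A -> Prop) :
  (forall t r s, P r -> P s -> P (t *: r + s)) -> (forall n, P (X ^+ n)) ->
  forall r, P r.
Proof.
move=> PD PX r; have [p ->] := hX.1 r.
have P0 : P 0 by rewrite -(addNr (X ^+ 0)) -scaleN1r; exact: PD.
rewrite /pcomb; elim/big_ind: _ => // [u v Pu Pv|i _].
  by rewrite -[u]scale1r; exact: PD.
by rewrite -[_ *: _]addr0; exact: PD.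
Qed.

Lemma pow_ext (U : lmodType k) (f g : A -> U) : linear f -> linear g ->
  (forall n, f (X ^+ n) = g (X ^+ n)) -> f =1 g.
Proof. by move=> lf lg e; apply: pow_ind => // t r s; rewrite lf lg => -> ->. Qed.

Lemma tens_pow_ext (U : lmodType k) (F G : A ⊗ A -> U) : linear F -> linear G ->
  (forall m n, F (X ^+ m ⊗ X ^+ n) = G (X ^+ m ⊗ X ^+ n)) -> F =1 G.
Proof.
move=> lF lG e; apply: tens_linear_ext => // u v.
apply: (pow_ext (f := fun u => F (u ⊗ v)) (g := fun u => G (u ⊗ v))) => [||m];
  try lin.
by apply: (pow_ext (f := fun v => F (X ^+ m ⊗ v)) (g := fun v => G (X ^+ m ⊗ v))) => [||n];
  try lin.
Qed.

Lemma tens_powZ (a b : k) m n :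
  (a *: X ^+ m) ⊗ (b *: X ^+ n) = (a * b) *: (X ^+ m ⊗ X ^+ n).
Proof.
rewrite tpureZl.
by rewrite tpureZr scalerA.
Qed.

(** The linear map sending X^n to f(n), computed from any polynomial expression
    of its argument.  It is well defined as soon as f(n) = 0 whenever
    X^n = 0, since relations between powers of X are homogeneous. *)
Definition pow_lift (U : lmodType k) (f : nat -> U) (r : A) : U :=
  pcomb f (projT1 (cid (hX.1 r))).

Section Lift.
Variables (U : lmodType k) (f : nat -> U).
Hypothesis hf : forall n, X ^+ n = 0 -> f n = 0.

Lemma pow_lift_pcomb p : pow_lift f (pcomb (fun i => X ^+ i) p) = pcomb f p.
Proof.
rewrite /pow_lift; case: cid => q /= e; apply/eqP.
rewrite -subr_eq0 -scaleN1r addrC -(pcomb_linear f); apply/eqP.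
set d := _ + q; have : pcomb (fun i => X ^+ i) d = 0.
  by rewrite pcomb_linear e scaleN1r addNr.
move/hX.2 => d0; rewrite /pcomb big1 // => i _.
by have /eqP := d0 i; rewrite scaler_eq0 => /orP[/eqP->|/eqP/hf->];
  rewrite ?scale0r ?scaler0.
Qed.

Lemma pow_lift_linear : linear (pow_lift f).
Proof.
move=> t r s; have [p ->] := hX.1 r; have [q ->] := hX.1 s.
by rewrite -(pcomb_linear (fun i => X ^+ i)) !pow_lift_pcomb pcomb_linear.
Qed.

Lemma pow_liftX n : pow_lift f (X ^+ n) = f n.
Proof. by rewrite -{1}(pcombXn (fun i => X ^+ i)) pow_lift_pcomb pcombXn. Qed.

End Lift.

Definition pow_diag (c : nat -> k) : A -> A := pow_lift (fun n => c n *: X ^+ n).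

Lemma pow_diag_linear c : linear (pow_diag c).
Proof. by apply: pow_lift_linear => n ->; rewrite scaler0. Qed.

Lemma pow_diagX c n : pow_diag c (X ^+ n) = c n *: X ^+ n.
Proof. by apply: pow_liftX => m ->; rewrite scaler0. Qed.

Lemma pow_diag_delta n p :
  pow_diag (fun i => (i == n)%:R) (pcomb (fun i => X ^+ i) p) = p`_n *: X ^+ n.
Proof.
by rewrite /pow_diag pow_lift_pcomb ?pcomb_delta // => m ->; rewrite scaler0.
Qed.

Definition pow_gr (n : nat) (r : A) : Prop := exists t : k, r = t *: X ^+ n.

(** The projections onto the components are the diagonal maps [pow_diag]. *)
Lemma pow_gr_direct : is_direct_decomposition pow_gr.
Proof.
split.
- by move=> n; exists 0; rewrite scale0r.
- move=> n t x y [u ->] [v ->]; exists (t * u + v).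
  by rewrite scalerDl scalerA.
- move=> x; have [p ->] := hX.1 x; exists (size p), (fun i => p`_i *: X ^+ i).
  by split=> // n; exists p`_n.
move=> N f gf s0 n ltnN.
have := congr1 (pow_diag (fun i => (i == n)%:R)) s0.
rewrite (lin_sum (pow_diag_linear _)) (lin0 (pow_diag_linear _)).
have E i : pow_diag (fun i => (i == n)%:R) (f i) = (i == n)%:R *: f i.
  have [t ->] := gf i.
  by rewrite (linZ (pow_diag_linear _)) pow_diagX !scalerA mulrC.
under eq_bigr => i _ do rewrite E.
rewrite (bigD1 (Ordinal ltnN)) //= eqxx scale1r big1 ?addr0 // => i ne.
by rewrite (_ : (i == n :> nat) = false) ?scale0r //; apply/negbTE.
Qed.

Lemma pow_comm (r s : A) : r * s = s * r.
Proof.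
have lml (u : A) : linear (fun v => u * v) by lin.
have lmr (u : A) : linear (fun v => v * u) by lin.
move: r; apply: pow_ext => // m; move: s; apply: pow_ext => // n.
by rewrite -!exprD addnC.
Qed.

Lemma pow_morphism (B : algType k) (y : B) : (forall n, X ^+ n = 0 -> y ^+ n = 0) ->
  exists phi : {lrmorphism A -> B}, phi X = y.
Proof.
move=> hy; pose f := pow_lift (fun n => y ^+ n).
have fX n : f (X ^+ n) = y ^+ n by exact: pow_liftX.
have lf : linear f by exact: pow_lift_linear.
have fM : {morph f : r s / r * s}.
  move=> r s.
  apply: (pow_ext (f := fun r => f (r * s)) (g := fun r => f r * f s)) => [||m]; try lin.
  apply: (pow_ext (f := fun s => f (X ^+ m * s)) (g := fun s => f (X ^+ m) * f s)) => [||n];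
    try lin.
  by rewrite -exprD !fX exprD.
have f1 : f 1 = 1 by rewrite -(expr0 X) fX.
pose phi : {lrmorphism A -> B} := HB.pack f (GRing.isLinear.Build k A B _ f lf)
  (GRing.isMonoidMorphism.Build A B f (conj f1 fM)).
by exists phi; rewrite -[X]expr1 [LHS]fX.
Qed.

End GradedGenerator.

Lemma sq0_pow (k : fieldType) (B : algType k) (y : B) n :
  y != 0 -> y ^+ 2 = 0 -> (y ^+ n == 0) = (1 < n)%N.
Proof.
move=> y0 y2; case: n => [|[|n]]; first by rewrite expr0 oner_eq0.
  by rewrite expr1 (negbTE y0).
by rewrite -addn2 exprD y2 mulr0 eqxx addn2.
Qed.

Lemma pow_morphism_bij (k : fieldType) (A B : algType k) (X : A) (y : B)
    (phi : {lrmorphism A -> B}) :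
  graded_generator X -> graded_generator y -> (forall n, y ^+ n = 0 -> X ^+ n = 0) ->
  phi X = y -> bijective phi.
Proof.
move=> hX hy hn phiX; have [psi psiy] := pow_morphism hy hn.
exists psi; [apply: (pow_ext hX)|apply: (pow_ext hy)]; try exact: linear_id.
- exact: linear_comp (linearP psi) (linearP phi).
- by move=> n; rewrite !rmorphXn /= phiX psiy.
- exact: linear_comp (linearP phi) (linearP psi).
- by move=> n; rewrite !rmorphXn /= psiy phiX.
Qed.

Lemma graded_generator_polyX (k : fieldType) : graded_generator ('X : {poly k}).
Proof.
split=> [r|p]; first by exists r; exact: poly_pow_sum.
by rewrite -poly_pow_sum => -> i; rewrite coef0 scale0r.
Qed.

(** * The polynomial ring modulo the square of the variable *)

Lemma pcomb_powM (k : fieldType) (A : algType k) (y : A) (p r : {poly k}) :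
  pcomb (fun i => y ^+ i) (p * r) = pcomb (fun i => y ^+ i) p * pcomb (fun i => y ^+ i) r.
Proof.
have lp := pcomb_linear (fun i => y ^+ i); have hP := graded_generator_polyX k.
have lml (B : algType k) (u : B) : linear (fun v => u * v) by lin.
have lmr (B : algType k) (u : B) : linear (fun v => v * u) by lin.
apply: (pow_ext hP (f := fun p => pcomb (fun i => y ^+ i) (p * r))
  (g := fun p => pcomb (fun i => y ^+ i) p * pcomb (fun i => y ^+ i) r)) => [||m].
- exact: linear_comp lp (lmr _ r).
- exact: linear_comp (lmr _ _) lp.
apply: (pow_ext hP (f := fun r => pcomb (fun i => y ^+ i) ('X^m * r))
  (g := fun r => pcomb (fun i => y ^+ i) 'X^m * pcomb (fun i => y ^+ i) r)) => [||n].
- exact: linear_comp lp (lml _ 'X^m).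
- exact: linear_comp (lml _ _) lp.
by rewrite -exprD !pcombXn exprD.
Qed.

Section DualNumbers.
Variable k : fieldType.
Local Notation Q := {poly %/ ('X^2 : {poly k})}.

Lemma qpolyX2_pow n : ('qX : Q) ^+ n = in_qpoly 'X^2 'X^n.
Proof. by rewrite rmorphXn. Qed.

Lemma qpolyX2_pcomb (p : {poly k}) :
  pcomb (fun i => ('qX : Q) ^+ i) p = in_qpoly 'X^2 p.
Proof.
have lq : linear (in_qpoly 'X^2 : {poly k} -> Q) := @in_qpoly_is_linear _ _.
rewrite [in RHS](poly_pow_sum p) /pcomb (lin_sum lq).
by apply: eq_bigr => i _; rewrite qpolyX2_pow (linZ lq).
Qed.

Lemma qpolyX2_powE n : (('qX : Q) ^+ n == 0) = (1 < n)%N.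
Proof.
rewrite qpolyX2_pow -val_eqE /= mk_monic_Xn /=.
case: ltnP => le.
  by rewrite -(subnK le) exprD Pdiv.RingMonic.rmodp_mull ?monicXn // eqxx.
rewrite Pdiv.CommonRing.rmodp_small ?size_polyXn //.
by rewrite -size_poly_eq0 size_polyXn.
Qed.

Lemma graded_generator_qpolyX : graded_generator ('qX : Q).
Proof.
split=> [r|p].
  exists (r : {poly k}); apply: val_inj; rewrite qpolyX2_pcomb /=.
  by rewrite Pdiv.CommonRing.rmodp_small // size_mk_monic.
rewrite qpolyX2_pcomb => /(congr1 val) /=; rewrite mk_monic_Xn /= => p0 i.
case: (ltnP i 2) => [lti|gei]; last first.
  by move: gei; rewrite -qpolyX2_powE => /eqP ->; rewrite scaler0.
rewrite (Pdiv.RingMonic.rdivp_eq (monicXn _ 2) p) p0 addr0 coefMXn lti.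
by rewrite scale0r.
Qed.

End DualNumbers.

(** * The coproduct operator and the skew derivation *)

Section TensorSpan.
Variable k : fieldType.

Lemma tspan_eq (V W U : lmodType k) (P : V -> W -> Prop) (F G : V ⊗ W -> U) t :
  linear F -> linear G -> (forall v w, P v w -> F (v ⊗ w) = G (v ⊗ w)) ->
  tspan P t -> F t = G t.
Proof.
move=> lF lG e [s Ps ->]; rewrite (lin_sum lF) (lin_sum lG).
by apply: eq_big_seq => p ps; apply: e; exact: Ps.
Qed.

Lemma tspan_pure (V W : lmodType k) (P : V -> W -> Prop) v w : P v w -> tspan P (v ⊗ w).
Proof.
move=> Pvw; exists [:: (v, w)]; last by rewrite big_seq1.
by move=> p; rewrite inE => /eqP ->.
Qed.

Lemma tspanD (V W : lmodType k) (P : V -> W -> Prop) s t :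
  tspan P s -> tspan P t -> tspan P (s + t).
Proof.
move=> [a Pa ->] [b Pb ->]; exists (a ++ b); last by rewrite big_cat.
by move=> p; rewrite mem_cat => /orP[/Pa|/Pb].
Qed.

Lemma tspan_map (V W V' W' : lmodType k) (P : V -> W -> Prop) (Q : V' -> W' -> Prop)
    (F : V ⊗ W -> V' ⊗ W') t :
  linear F -> (forall v w, P v w -> tspan Q (F (v ⊗ w))) -> tspan P t -> tspan Q (F t).
Proof.
move=> lF H [s Ps ->]; rewrite (lin_sum lF).
elim: s Ps => [|p s IH] Ps; first by rewrite big_nil; exists [::]; rewrite ?big_nil.
rewrite big_cons; apply: tspanD; first by apply: H; apply: Ps; rewrite mem_head.
by apply: IH => r rs; apply: Ps; rewrite inE rs orbT.
Qed.

End TensorSpan.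

Section BraidedProduct.
Variables (k : fieldType) (H : algType k) (R : algType k) (Y : yd_data H R).
Hypotheses (ba : bilin (act Y)) (lc : linear (coact Y)).

Lemma braiding_linear : linear (braiding Y Y).
Proof. rewrite /braiding; lin. Qed.

Lemma bmul_linearl t : linear (fun s => bmul Y s t).
Proof. have lb := braiding_linear; rewrite /bmul; lin. Qed.

Lemma bmul_linearr s : linear (fun t => bmul Y s t).
Proof. have lb := braiding_linear; rewrite /bmul; lin. Qed.

Lemma bmul_pure x y x' y' : bmul Y (x ⊗ y) (x' ⊗ y') =
  tlift (fun p q => (x * p) ⊗ (q * y')) (braiding Y Y (y ⊗ x')).
Proof.
have lb := braiding_linear; rewrite /bmul tlift_pure; last by lin.
by rewrite tlift_pure //; lin.
Qed.

Lemma braiding_pure x y :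
  braiding Y Y (x ⊗ y) = tlift (fun h r => act Y h y ⊗ r) (coact Y x).
Proof. by rewrite /braiding tlift_pure //; lin. Qed.

End BraidedProduct.

Section TwistedMultiplication.
Variables (k : fieldType) (A : algType k) (X : A) (sigma : A -> A).

(** Left multiplication by X (x) 1 + 1 (x) X in the braided tensor square, when
    sigma is the action on A of the grouplike attached to X. *)
Definition twist_mul (t : A ⊗ A) : A ⊗ A :=
  tlift (fun u v => (X * u) ⊗ v + sigma u ⊗ (X * v)) t.

Hypothesis ls : linear sigma.

Lemma twist_mul_bilin : bilin (fun u v => (X * u) ⊗ v + sigma u ⊗ (X * v)).
Proof. lin. Qed.

Lemma twist_mul_linear : linear twist_mul.
Proof. exact: tlift_linear twist_mul_bilin. Qed.

Lemma twist_mul_pure u v : twist_mul (u ⊗ v) = (X * u) ⊗ v + sigma u ⊗ (X * v).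
Proof. exact: tlift_pure twist_mul_bilin. Qed.

End TwistedMultiplication.

(** The quantum integer 1 + q + ... + q^(n-1). *)
Definition qint (k : fieldType) (q : k) (n : nat) : k := \sum_(i < n) q ^+ i.

Lemma qintS (k : fieldType) (q : k) n : qint q n.+1 = 1 + q * qint q n.
Proof.
rewrite /qint big_ord_recl expr0 mulr_sumr; congr (_ + _).
by apply: eq_bigr => i _; rewrite exprS.
Qed.

Lemma qint1_neq0 (k : fieldType) n : [pchar k] =i pred0 -> qint (1 : k) n.+1 != 0.
Proof.
move=> chark; rewrite /qint; under eq_bigr => i _ do rewrite expr1n.
by rewrite sumr_const card_ord ((pcharf0P _).1 chark).
Qed.

Section SkewDerivation.
Variables (k : fieldType) (A : algType k) (X : A) (q : k) (sigma : A -> A).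
Variables (Delta : A -> A ⊗ A) (eps : A -> k^o).
Hypotheses (hX : graded_generator X) (X0 : X != 0).
Hypotheses (ls : linear sigma) (sX : forall n, sigma (X ^+ n) = q ^+ n *: X ^+ n).
Hypotheses (hC : is_coalgebra Delta eps) (eX : forall n, eps (X ^+ n) = (n == 0%N)%:R).
Hypotheses (D1 : Delta 1 = 1 ⊗ 1).
Hypotheses (DX : forall r, Delta (X * r) = twist_mul X sigma (Delta r)).

Let lD : linear Delta. Proof. by case: hC. Qed.
Let le : linear eps. Proof. by case: hC. Qed.

Definition coef1 : A -> k^o := pow_lift hX (fun n => (n == 1%N)%:R).

Let hcoef1 n : X ^+ n = 0 -> ((n == 1%N)%:R : k^o) = 0.
Proof. by case: eqP => // ->; rewrite expr1 => /eqP; rewrite (negbTE X0). Qed.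

Lemma coef1_linear : linear coef1. Proof. exact: pow_lift_linear hcoef1. Qed.
Lemma coef1X n : coef1 (X ^+ n) = (n == 1%N)%:R. Proof. exact: pow_liftX hcoef1 n. Qed.

Let lc := coef1_linear.

(** (lambda (x) id) Delta, where lambda is the coefficient of X: the quantum
    partial derivative along X. *)
Definition skew_der (r : A) : A := tlift (fun u v => (coef1 u : k) *: v) (Delta r).

Lemma skew_der_linear : linear skew_der.
Proof. by rewrite /skew_der; lin. Qed.

Lemma skew_der1 : skew_der 1 = 0.
Proof.
by rewrite /skew_der D1 tlift_pure ?(coef1X 0) ?scale0r //; lin.
Qed.

(** The two terms come from those of [twist_mul]: lambda(X u) is the counit of
    u, and lambda(sigma u) = q lambda(u). *)
Lemma skew_derM r : skew_der (X * r) = r + q *: (X * skew_der r).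
Proof.
have lt := twist_mul_linear X ls.
have bl : bilin (fun u v => (coef1 u : k) *: (v : A)) by lin.
have be : bilin (fun u v => (eps u : k) *: (v : A)) by lin.
have e1 u : coef1 (X * u) = eps u.
  apply: (pow_ext hX (f := fun u => coef1 (X * u))) => [||n]; try lin.
  by rewrite -exprS coef1X eX eqSS.
have e2 u : coef1 (sigma u) = q *: coef1 u.
  apply: (pow_ext hX (f := fun u => coef1 (sigma u)) (g := fun u => q *: coef1 u))
    => [||n]; try lin.
  rewrite sX (linZ lc) coef1X.
  by case: eqP => [->|_]; rewrite ?expr1 ?scaler0.
rewrite /skew_der DX -[X in _ = X + _](counitl_tlift hC r (@linear_id _ _)).
move: (Delta r); apply: tens_linear_ext; try lin.
move=> u v; rewrite twist_mul_pure // (linD (tlift_linear bl)) !tlift_pure //.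
by rewrite e1 e2 algZMr scalerA.
Qed.

Lemma skew_derX n : skew_der (X ^+ n.+1) = qint q n.+1 *: X ^+ n.
Proof.
elim: n => [|n IH].
  rewrite expr1 -{1}[X]mulr1 skew_derM skew_der1 mulr0 scaler0 addr0 expr0.
  by rewrite /qint big_ord1 expr0 scale1r.
rewrite exprS skew_derM IH algZMr -exprS scalerA -{1}[X ^+ n.+1]scale1r -scalerDl.
by rewrite -qintS.
Qed.

(** For r primitive, d(r) is the constant lambda(r), while d multiplies the
    component of degree n by (n)_q and lowers its degree; so components of
    degree at least two vanish.  The counit kills the component of degree
    zero. *)
Lemma primitive_degree1 r :
  (forall n, X ^+ n.+1 != 0 -> qint q n.+1 != 0) ->
  (Delta r = r ⊗ 1 + 1 ⊗ r <-> exists t : k, r = t *: X).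
Proof.
move=> hq; have bt := tpure_bilinear A A; split; last first.
  move=> [t ->]; have lr : linear (fun r => r ⊗ 1 + (1 : A) ⊗ r) by lin.
  rewrite (linZ lD) [RHS](linZ lr); congr (_ *: _).
  rewrite -[X in Delta X]mulr1 DX D1 twist_mul_pure // mulr1.
  by have := sX 0; rewrite expr0 scale1r => ->.
move=> prim; pose F n := pow_diag hX (fun i => (i == n)%:R).
have lF n : linear (F n) by exact: pow_diag_linear.
have be : bilin (fun u v => (eps u : k) *: (v : A)) by lin.
have bl : bilin (fun u v => (coef1 u : k) *: (v : A)) by lin.
have dr : skew_der r = (coef1 r : k) *: 1.
  rewrite /skew_der prim (linD (tlift_linear bl)) !tlift_pure //.
  by rewrite (coef1X 0) scale0r addr0.
have er : eps r = 0.
  have [_ _ _ e _] := hC; have := e r.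
  rewrite prim (linD (tlift_linear be)) !tlift_pure // (eX 0) scale1r.
  move/eqP; rewrite -subr_eq0 addrK scaler_eq0 oner_eq0 orbF => /eqP.
  by [].
have F0 : F 0%N r = 0.
  have -> : F 0%N r = (eps r : k) *: 1.
    apply: (pow_ext hX (g := fun r => (eps r : k) *: 1)) => [//||n]; first by lin.
    rewrite /F pow_diagX eX; case: eqP => [->|_]; first by rewrite expr0.
    by rewrite !scale0r.
  by rewrite er scale0r.
(* The component of d(r) in degree n+1 >= 1 is zero. *)
have Fn n : F n.+2 r = 0.
  have ld := skew_der_linear.
  have Fd s : X * F n.+1 (skew_der s) = qint q n.+2 *: F n.+2 s.
    have lF1 := lF n.+1; have lF2 := lF n.+2.
    apply: (pow_ext hX (f := fun s => X * F n.+1 (skew_der s))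
      (g := fun s => qint q n.+2 *: F n.+2 s)) => [||m]; try lin.
    case: m => [|m].
      rewrite expr0 skew_der1 (lin0 lF1) mulr0.
      by rewrite -(expr0 X) /F pow_diagX scale0r scaler0.
    rewrite skew_derX (linZ lF1) algZMr /F !pow_diagX algZMr -exprS !scalerA eqSS.
    by case: eqP => [->|_]; rewrite ?mulr0.
  have := Fd r; rewrite dr (linZ (lF _)) -(expr0 X) {1}/F pow_diagX scale0r.
  rewrite scaler0 mulr0 => /esym/eqP; rewrite scaler_eq0.
  have [Xn|Xn] := eqVneq (X ^+ n.+2) 0.
    move=> _; have : forall s, F n.+2 s = (fun=> 0) s; last exact.
    apply: (pow_ext hX) => [//||m]; first by move=> t u v; rewrite scaler0 addr0.
    by rewrite /F pow_diagX; case: eqP => [->|_]; rewrite ?Xn ?scaler0 ?scale0r.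
  by rewrite (negbTE (hq _ Xn)) => /eqP.
have [p ep] := hX.1 r; exists p`_1.
rewrite -[X in _ *: X]expr1 -(pcomb_delta (fun i => X ^+ i)) [LHS]ep.
apply: eq_bigr => i _; have := pow_diag_delta hX i p; rewrite -ep -/(F i r).
case: (i : nat) => [|[|m]] /=; rewrite ?F0 ?Fn ?scale1r ?scale0r ?scaler0 //.
Qed.

End SkewDerivation.

(** * The braided Hopf algebra structure on a graded algebra with one generator *)

Section Construction.
Variable k : fieldType.
Variables (H : algType k) (D : hopf_data H).
Hypothesis hD : is_hopf D.
Variables (chi : H -> k^o) (g : H).
Hypotheses (hchi : character chi) (hg : grouplike D g) (hyd : yd_pair D chi g).
Variables (A : algType k) (X : A).
Hypothesis hX : graded_generator X.
Local Notation q := (chi g : k).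
Local Notation cpow := (conv_pow D chi).

Definition line_act (h : H) : A -> A := pow_diag hX (fun n => cpow n h).
Definition line_coact : A -> H ⊗ A := pow_lift hX (fun n => g ^+ n ⊗ X ^+ n).
Definition line_yd : yd_data H A := YDData line_act line_coact.
Definition line_comul : A -> A ⊗ A :=
  pow_lift hX (fun n => iter n (twist_mul X (line_act g)) (1 ⊗ 1)).
Definition line_counit : A -> k^o := pow_lift hX (fun n => (n == 0%N)%:R).
(** The general formula for the antipode has the extra factor q^(n(n-1)/2); it
    is 1 on the nonzero powers of X in the two cases q = 1 and X^2 = 0. *)
Definition line_antip : A -> A := pow_diag hX (fun n => (-1) ^+ n).
Definition line_bh : braided_hopf_data H A :=
  BraidedHopfData line_yd line_comul line_counit line_antip.

Local Notation sigma := (line_act g).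
Local Notation Theta := (twist_mul X sigma).

(* [hTheta] makes the coproduct well defined.  [hq] holds both for q = 1 and *)
(* for X^2 = 0, and gives X sigma(u) = X u, which the antipode axioms need. *)
Hypothesis hTheta : forall n, X ^+ n = 0 -> iter n Theta (1 ⊗ 1) = 0.
Hypothesis hq : q *: X ^+ 2 = X ^+ 2.
Hypothesis X0 : X != 0.

Let hDC : is_coalgebra (comul D) (counit D). Proof. by case: hD. Qed.
Let lDelta : linear (comul D). Proof. by case: hDC. Qed.
Let leps : linear (counit D). Proof. by case: hDC. Qed.
Let lS : linear (antip D). Proof. by case: hD => _ _ _ []. Qed.
Let lchi : linear chi. Proof. by case: hchi. Qed.
Let hcpow n : character (cpow n). Proof. exact: character_conv_pow. Qed.
Let lcpow n : linear (cpow n). Proof. by case: (hcpow n). Qed.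

Lemma line_actX h n : line_act h (X ^+ n) = cpow n h *: X ^+ n.
Proof. exact: pow_diagX. Qed.

Lemma line_act_bilin : bilin line_act.
Proof.
split=> [h|r]; first exact: pow_diag_linear.
move=> t u v; apply: (pow_ext hX (f := fun r => line_act (t *: u + v) r)
   (g := fun r => t *: line_act u r + line_act v r)) => [||n].
- exact: pow_diag_linear.
- have l1 : linear (line_act u) by exact: pow_diag_linear.
  have l2 : linear (line_act v) by exact: pow_diag_linear.
  lin.
by rewrite !line_actX lcpow scalerDl scalerA.
Qed.
Let bact := line_act_bilin.

Let ls : linear sigma. Proof. exact: bact.1. Qed.
Let lTheta : linear Theta. Proof. exact: twist_mul_linear. Qed.

Lemma line_sigmaX n : sigma (X ^+ n) = q ^+ n *: X ^+ n.
Proof.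
by rewrite line_actX -[g]expr1 (conv_pow_grouplike hD n 1 hchi hg) expr1 mul1n.
Qed.

Let hcoact n : X ^+ n = 0 -> g ^+ n ⊗ X ^+ n = 0.
Proof. by move->; exact: tpure0r. Qed.

Lemma line_coactX n : line_coact (X ^+ n) = g ^+ n ⊗ X ^+ n.
Proof. exact: pow_liftX hcoact n. Qed.

Lemma line_coact_linear : linear line_coact.
Proof. exact: pow_lift_linear hcoact. Qed.
Let lcoact := line_coact_linear.

Lemma line_comul_linear : linear line_comul.
Proof. exact: pow_lift_linear hTheta. Qed.
Let lcomul := line_comul_linear.

Lemma line_comul1 : line_comul 1 = 1 ⊗ 1.
Proof. by rewrite -(expr0 X) /line_comul pow_liftX // expr0. Qed.

Lemma line_comulM r : line_comul (X * r) = Theta (line_comul r).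
Proof.
apply: (pow_ext hX (f := fun r => line_comul (X * r))
  (g := fun r => Theta (line_comul r))) => [||n]; try lin.
by rewrite -exprS /line_comul !pow_liftX.
Qed.

Let hcounit n : X ^+ n = 0 -> ((n == 0%N)%:R : k^o) = 0.
Proof. by case: n => // /eqP; rewrite expr0 oner_eq0. Qed.

Lemma line_counitX n : line_counit (X ^+ n) = (n == 0%N)%:R.
Proof. exact: pow_liftX hcounit n. Qed.

Lemma line_counit_linear : linear line_counit.
Proof. exact: pow_lift_linear hcounit. Qed.
Let lcounit := line_counit_linear.

Lemma line_counitM r s : line_counit (r * s) = line_counit r * line_counit s.
Proof.
apply: (pow_ext hX (f := fun r => line_counit (r * s))
  (g := fun r => line_counit r * line_counit s)) => [||m]; try lin.
apply: (pow_ext hX (f := fun s => line_counit (X ^+ m * s))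
  (g := fun s => line_counit (X ^+ m) * line_counit s)) => [||n]; try lin.
by rewrite -exprD !line_counitX addn_eq0 -natrM mulnb.
Qed.

Lemma line_antip_linear : linear line_antip.
Proof. exact: pow_diag_linear. Qed.
Let lantip := line_antip_linear.

Lemma line_antipX n : line_antip (X ^+ n) = (-1) ^+ n *: X ^+ n.
Proof. exact: pow_diagX. Qed.

Lemma line_is_module : is_module line_yd.
Proof.
split=> //= [m|f h m].
  apply: (pow_ext hX (f := line_act 1) (g := id)) => [||n]; try lin.
  by have [_ e _] := hcpow n; rewrite line_actX e scale1r.
apply: (pow_ext hX (f := line_act (f * h)) (g := fun r => line_act f (line_act h r)))
  => [||n]; try lin.
have [_ _ e] := hcpow n.
by rewrite !line_actX (linZ (bact.1 f)) line_actX scalerA e mulrC.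
Qed.

Lemma line_is_comodule : is_comodule D line_yd.
Proof.
split=> //= m.
  apply: (pow_ext hX (f := fun m => tassoc (tmap (comul D) id (line_coact m)))
    (g := fun m => tmap id line_coact (line_coact m))) => [||n]; try lin.
  rewrite line_coactX /tmap !tlift_pure; try lin.
  rewrite line_coactX (grouplikeX hD n hg).1 /tassoc !tlift_pure //; lin.
apply: (pow_ext hX (f := fun m => tlift _ (line_coact m)) (g := id)) => [||n]; try lin.
rewrite line_coactX tlift_pure; last by lin.
by rewrite (grouplikeX hD n hg).2 scale1r.
Qed.

(** On X^n the condition is [yd_pair_coact] for the pair (chi^n, g^n). *)
Lemma line_is_yd : is_yd D line_yd.
Proof.
split; [exact: line_is_module|exact: line_is_comodule|].
move=> h m /=.
pose G h1 h2 h3 m :=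
  tlift (fun n m0 => (h1 * n * antip D h3) ⊗ line_act h2 m0) (line_coact m).
have bG : bilin (fun h12 h3 => tlift (fun h1 h2 => G h1 h2 h3 m) h12) by rewrite /G; lin.
rewrite [RHS](tlift_tmap (comul D) id _ bG).
apply: (pow_ext hX (f := fun m => line_coact (line_act h m))
  (g := fun m => tlift (fun p q =>
    tlift (fun h1 h2 => G h1 h2 q m) (comul D p)) (comul D h)))
  => [||n]; try by rewrite /G; lin.
rewrite line_actX (linZ lcoact) line_coactX.
have <- : ((cpow n h : k) *: g ^+ n) ⊗ X ^+ n = (cpow n h : k) *: (g ^+ n ⊗ X ^+ n).
  exact: tpureZl.
rewrite -(yd_pair_coact hD h (lcpow n) (yd_pair_pow hD n hchi hyd)).
rewrite (lin_tlift (L := fun v => v ⊗ X ^+ n)); last by lin.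
apply: eq_tlift => p h3.
rewrite (lin_tlift (L := fun v => v ⊗ X ^+ n)); last by lin.
apply: eq_tlift => h1 h2; rewrite /G line_coactX tlift_pure; last by lin.
rewrite line_actX tpureZl.
by rewrite tpureZr.
Qed.

Local Notation act2 := (act (yd_tensor D line_yd line_yd)).
Local Notation coact2 := (coact (yd_tensor D line_yd line_yd)).
Local Notation braid := (braiding line_yd line_yd).

Lemma act2_linear h : linear (act2 h).
Proof. rewrite /=; lin. Qed.
Lemma coact2_linear : linear coact2.
Proof. rewrite /=; lin. Qed.
Lemma act2X h m n : act2 h (X ^+ m ⊗ X ^+ n) = (cpow (m + n) h : k) *: (X ^+ m ⊗ X ^+ n).
Proof.
rewrite (conv_powD hD _ _ _ lchi) /conv /=.
rewrite [RHS](lin_tlift (L := fun v : k^o => (v : k) *: (X ^+ m ⊗ X ^+ n))); last by lin.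
apply: eq_tlift => h1 h2; rewrite /tmap tlift_pure; last by lin.
by rewrite !line_actX tens_powZ.
Qed.

Lemma coact2X m n : coact2 (X ^+ m ⊗ X ^+ n) = g ^+ (m + n) ⊗ (X ^+ m ⊗ X ^+ n).
Proof.
rewrite /= tlift_pure; last by lin.
rewrite !line_coactX tlift_pure; last by lin.
by rewrite tlift_pure ?exprD; last by lin.
Qed.

Lemma braidX m n : braid (X ^+ m ⊗ X ^+ n) = q ^+ (m * n) *: (X ^+ n ⊗ X ^+ m).
Proof.
rewrite (braiding_pure (Y := line_yd) bact lcoact) /=.
rewrite line_coactX tlift_pure; last by lin.
rewrite line_actX tpureZl.
by rewrite (conv_pow_grouplike hD n m hchi hg).
Qed.

Let lact2 := act2_linear.
Let lcoact2 := coact2_linear.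
Let lbl := bmul_linearl (Y := line_yd) bact lcoact.
Let lbr := bmul_linearr (Y := line_yd) bact lcoact.

Lemma bmulX i j m n : bmul line_yd (X ^+ i ⊗ X ^+ j) (X ^+ m ⊗ X ^+ n) =
  q ^+ (j * m) *: (X ^+ (i + m) ⊗ X ^+ (j + n)).
Proof.
rewrite (bmul_pure (Y := line_yd) bact lcoact).
have bl : bilin (fun p s => (X ^+ i * p) ⊗ (s * X ^+ n)) by lin.
by rewrite braidX (linZ (tlift_linear bl)) tlift_pure // -!exprD.
Qed.

Lemma ThetaX m n : Theta (X ^+ m ⊗ X ^+ n) =
  X ^+ m.+1 ⊗ X ^+ n + q ^+ m *: (X ^+ m ⊗ X ^+ n.+1).
Proof.
rewrite twist_mul_pure // line_sigmaX -!exprS; congr (_ + _).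
exact: tpureZl.
Qed.

(** Left multiplication by Delta(X) commutes with right multiplications: this
    instance of associativity in the braided tensor square is all that the
    multiplicativity of the coproduct uses. *)
Lemma Theta_bmul s t : Theta (bmul line_yd s t) = bmul line_yd (Theta s) t.
Proof.
apply: (tens_pow_ext hX (F := fun s => Theta (bmul line_yd s t))
  (G := fun s => bmul line_yd (Theta s) t)) => [||i j]; try lin.
apply: (tens_pow_ext hX (F := fun t => Theta (bmul line_yd (X ^+ i ⊗ X ^+ j) t))
  (G := fun t => bmul line_yd (Theta (X ^+ i ⊗ X ^+ j)) t)) => [||m n]; try lin.
rewrite bmulX (linZ lTheta) !ThetaX (linD (lbl _)) (linZ (lbl _)) !bmulX.
rewrite scalerDr !scalerA !addSn; congr (_ + _ *: _).
by rewrite -!exprD mulSn addnC addnA.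
Qed.

Lemma line_comul_bmul r s :
  line_comul (r * s) = bmul line_yd (line_comul r) (line_comul s).
Proof.
have e1 : bmul line_yd (1 ⊗ 1) (line_comul s) = line_comul s.
  move: (line_comul s); apply: (tens_pow_ext hX) => [//||m n]; first exact: linear_id.
  by have := bmulX 0 0 m n; rewrite !expr0 scale1r.
move: r; apply: (pow_ind hX) => [t u v Hu Hv|n].
  by rewrite mulrDl algZMl !lcomul Hu Hv lbl.
elim: n => [|n IH]; first by rewrite expr0 mul1r line_comul1 e1.
by rewrite exprS -mulrA !line_comulM IH Theta_bmul.
Qed.

Definition tdeg (n : nat) (u v : A) : Prop :=
  exists i j, [/\ (i + j)%N = n, pow_gr X i u & pow_gr X j v].

Lemma Theta_tdeg n t : tspan (tdeg n) t -> tspan (tdeg n.+1) (Theta t).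
Proof.
apply: tspan_map => // u v [i [j [<- [a ->] [b ->]]]].
rewrite twist_mul_pure //; apply: tspanD; apply: tspan_pure.
  exists i.+1, j; split; [by []|exists a|by exists b].
  by rewrite algZMr exprS.
exists i, j.+1; split; first by rewrite addnS.
  by rewrite (linZ ls) line_sigmaX; exists (a * q ^+ i); rewrite scalerA.
by exists b; rewrite algZMr exprS.
Qed.

Lemma line_comul_tdeg n : tspan (tdeg n) (line_comul (X ^+ n)).
Proof.
elim: n => [|n IH]; last by rewrite exprS line_comulM; exact: Theta_tdeg.
rewrite expr0 line_comul1; apply: tspan_pure; exists 0%N, 0%N; split=> //;
  by exists 1; rewrite scale1r.
Qed.

(** H-linearity and H-colinearity are checked on homogeneous tensors, where H
    acts and coacts through the total degree. *)
Lemma tdeg_ext (U : lmodType k) n (F G : A ⊗ A -> U) : linear F -> linear G ->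
  (forall i j, (i + j)%N = n -> F (X ^+ i ⊗ X ^+ j) = G (X ^+ i ⊗ X ^+ j)) ->
  F (line_comul (X ^+ n)) = G (line_comul (X ^+ n)).
Proof.
move=> lF lG e; apply: (tspan_eq lF lG _ (line_comul_tdeg n)).
move=> u v [i [j [ij [a ->] [b ->]]]].
by rewrite tens_powZ (linZ lF) (linZ lG) e.
Qed.

Lemma line_sigma_comul r :
  line_comul (sigma r) = tmap sigma sigma (line_comul r).
Proof.
apply: (pow_ext hX (f := fun r => line_comul (sigma r))
  (g := fun r => tmap sigma sigma (line_comul r))) => [||n]; try lin.
rewrite line_sigmaX (linZ lcomul).
apply: (tdeg_ext (F := fun t => q ^+ n *: t) (G := tmap sigma sigma)) => [||i j <-]; try lin.
rewrite /tmap tlift_pure; last by lin.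
by rewrite !line_sigmaX tens_powZ exprD.
Qed.

(** Both iterated coproducts intertwine Theta with the same operator on
    A (x) A (x) A, namely left multiplication by
    X (x) 1 (x) 1 + 1 (x) X (x) 1 + 1 (x) 1 (x) X. *)
Lemma line_coassoc r : tassoc (tmap line_comul id (line_comul r)) =
  tmap id line_comul (line_comul r).
Proof.
pose Theta3 : A ⊗ (A ⊗ A) -> A ⊗ (A ⊗ A) :=
  tlift (fun u t => (X * u) ⊗ t + sigma u ⊗ Theta t).
have b3 : bilin (fun u t => (X * u) ⊗ t + sigma u ⊗ Theta t) by lin.
have l3 : linear Theta3 by exact: tlift_linear.
have lL : linear (fun r => tassoc (tmap line_comul (id : A -> A) r)) by lin.
have lR : linear (tmap (id : A -> A) line_comul) by lin.
have eR t : tmap id line_comul (Theta t) = Theta3 (tmap id line_comul t).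
  apply: (tens_linear_ext (f := fun t => tmap id line_comul (Theta t))
    (g := fun t => Theta3 (tmap id line_comul t))) => [||u v]; try lin.
  rewrite twist_mul_pure // (linD lR) /tmap !tlift_pure; try lin.
  by rewrite line_comulM /Theta3 tlift_pure.
have eL t : tassoc (tmap line_comul id (Theta t)) = Theta3 (tassoc (tmap line_comul id t)).
  apply: (tens_linear_ext (f := fun t => tassoc (tmap line_comul id (Theta t)))
    (g := fun t => Theta3 (tassoc (tmap line_comul id t)))) => [||u v]; try lin.
  rewrite twist_mul_pure // (linD lL) /tmap !tlift_pure; try lin.
  rewrite line_comulM line_sigma_comul.
  have lA (w : A) : linear (fun t => tassoc (U := A) (V := A) (t ⊗ w)) by lin.
  apply: (tens_linear_ext (f := fun s => tassoc (Theta s ⊗ v) +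
    tassoc (tmap sigma sigma s ⊗ (X * v))) (g := fun s => Theta3 (tassoc (s ⊗ v))))
    => [||a b]; try lin.
  have eA (x y z : A) : tassoc ((x ⊗ y) ⊗ z) = x ⊗ (y ⊗ z).
    by rewrite /tassoc !tlift_pure //; lin.
  rewrite twist_mul_pure // /tmap tlift_pure; last by lin.
  have lA1 := lA v.
  rewrite (linD lA1) !eA /Theta3 tlift_pure // twist_mul_pure //.
  by rewrite tpureDr addrA.
move: r; apply: (pow_ind hX) => [t u v Hu Hv|n].
  by rewrite lcomul lL lR Hu Hv.
elim: n => [|n IH]; last by rewrite exprS line_comulM eL eR IH.
rewrite expr0 line_comul1 /tmap !tlift_pure; try lin.
by rewrite line_comul1 /tassoc !tlift_pure //; lin.
Qed.

Lemma line_counit_mulX u : line_counit (X * u) = 0.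
Proof. by rewrite line_counitM -[X]expr1 line_counitX mul0r. Qed.

Lemma line_counit1 : line_counit 1 = 1.
Proof. by rewrite -(expr0 X) line_counitX. Qed.

Lemma line_counit_sigma u : line_counit (sigma u) = line_counit u.
Proof.
apply: (pow_ext hX (f := fun u => line_counit (sigma u))) => [||n]; try lin.
rewrite line_sigmaX (linZ lcounit) line_counitX.
by case: eqP => [->|_]; rewrite ?expr0 ?scale1r ?scaler0.
Qed.

Lemma line_is_coalgebra : is_coalgebra line_comul line_counit.
Proof.
have bl : bilin (fun y z => (line_counit y : k) *: (z : A)) by lin.
have br : bilin (fun y z => (line_counit z : k) *: (y : A)) by lin.
split=> //; [exact: line_coassoc| |].
  have e t : tlift (fun y z => (line_counit y : k) *: (z : A)) (Theta t) =
      X * tlift (fun y z => (line_counit y : k) *: (z : A)) t.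
    move: t; apply: tens_linear_ext => [||u v]; try lin.
    rewrite twist_mul_pure // (linD (tlift_linear bl)) !tlift_pure //.
    by rewrite line_counit_mulX scale0r add0r line_counit_sigma algZMr.
  apply: (pow_ind hX) => [t u v Hu Hv|n].
    by rewrite lcomul (tlift_linear bl) Hu Hv.
  elim: n => [|n IH]; last by rewrite exprS line_comulM e IH.
  by rewrite expr0 line_comul1 tlift_pure // line_counit1 scale1r.
have e t : tlift (fun y z => (line_counit z : k) *: (y : A)) (Theta t) =
    X * tlift (fun y z => (line_counit z : k) *: (y : A)) t.
  move: t; apply: tens_linear_ext => [||u v]; try lin.
  rewrite twist_mul_pure // (linD (tlift_linear br)) !tlift_pure //.
  by rewrite line_counit_mulX scale0r addr0 algZMr.
apply: (pow_ind hX) => [t u v Hu Hv|n].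
  by rewrite lcomul (tlift_linear br) Hu Hv.
elim: n => [|n IH]; last by rewrite exprS line_comulM e IH.
by rewrite expr0 line_comul1 tlift_pure // line_counit1 scale1r.
Qed.

(** sigma multiplies X^n by q^n, and q X^2 = X^2: the twist disappears after
    multiplication by X. *)
Lemma mulX_sigma u : X * sigma u = X * u.
Proof.
apply: (pow_ext hX (f := fun u => X * sigma u)) => [||n]; try lin.
rewrite line_sigmaX algZMr -exprS.
case: n => [|n]; first by rewrite expr0 scale1r.
have hqn m : q *: X ^+ m.+2 = X ^+ m.+2.
  by rewrite -addn2 exprD -algZMr hq.
elim: n => [|n IH]; first by rewrite expr1 hqn.
by rewrite exprSr -scalerA hqn (exprS X) -algZMr IH -exprS.
Qed.

Lemma line_antip_mulX u : line_antip (X * u) = - (X * line_antip u).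
Proof.
apply: (pow_ext hX (f := fun u => line_antip (X * u))
  (g := fun u => - (X * line_antip u))) => [||n]; try lin.
  by move=> t v w; rewrite lantip mulrDr algZMr opprD scalerN.
by rewrite -exprS !line_antipX algZMr -exprS exprS mulN1r scaleNr.
Qed.

Lemma line_sigma_antip u : sigma (line_antip u) = line_antip (sigma u).
Proof.
apply: (pow_ext hX (f := fun u => sigma (line_antip u))
  (g := fun u => line_antip (sigma u))) => [||n]; try lin.
rewrite line_antipX line_sigmaX (linZ ls) (linZ lantip) line_antipX line_sigmaX.
by rewrite !scalerA mulrC.
Qed.

(** On the image of Theta the two terms of S * id cancel, because
    S(X u) v + S(sigma u) X v = - X S(u) v + X S(u) v by [mulX_sigma]; the same
    happens for id * S. *)
Lemma line_is_antipode : is_antipode line_comul line_counit line_antip.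
Proof.
have bl : bilin (fun y z => line_antip y * z) by lin.
have br : bilin (fun y z => y * line_antip z) by lin.
have cm := pow_comm hX.
have a1 : line_antip 1 = 1 by rewrite -(expr0 X) line_antipX scale1r.
have dec (F : A -> A) : linear F -> F 1 = 1 -> (forall r, F (X * r) = 0) ->
    forall r, F r = (line_counit r : k) *: 1.
  move=> lF F1 FX; apply: (pow_ext hX) => [//||n]; first by lin.
  rewrite line_counitX; case: n => [|n]; first by rewrite expr0 F1 scale1r.
  by rewrite exprS FX scale0r.
split=> //.
  apply: dec; first by lin.
    by rewrite line_comul1 tlift_pure // mulr1.
  move=> r; rewrite line_comulM; move: (line_comul r).
  apply: (tens_linear_ext (g := fun=> 0)) => [||u v]; first by lin.
    by move=> t y z; rewrite scaler0 addr0.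
  rewrite twist_mul_pure // (linD (tlift_linear bl)) !tlift_pure //.
  rewrite line_antip_mulX -line_sigma_antip mulrA -(cm X) mulX_sigma.
  by rewrite mulNr addNr.
apply: dec; first by lin.
  by rewrite line_comul1 tlift_pure // a1 mulr1.
move=> r; rewrite line_comulM; move: (line_comul r).
apply: (tens_linear_ext (g := fun=> 0)) => [||u v]; first by lin.
  by move=> t y z; rewrite scaler0 addr0.
rewrite twist_mul_pure // (linD (tlift_linear br)) !tlift_pure //.
by rewrite line_antip_mulX mulrN mulrA -(cm X) mulX_sigma subrr.
Qed.

Lemma line_mul_morph : yd_morph (yd_tensor D line_yd line_yd) line_yd
  (tlift (fun x y : A => x * y)).
Proof.
have bm : bilin (fun x y : A => x * y) by lin.
split; first exact: tlift_linear.
  move=> h; apply: (tens_pow_ext hX (F := fun t => _ (act2 h t))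
    (G := fun t => line_act h (tlift (fun x y : A => x * y) t))) => [||m n]; try lin.
  by rewrite act2X (linZ (tlift_linear bm)) tlift_pure // -exprD line_actX.
apply: (tens_pow_ext hX (F := fun t => line_coact (tlift (fun x y : A => x * y) t))
    (G := fun t => tmap id (tlift (fun x y : A => x * y)) (coact2 t))) => [||m n]; try lin.
rewrite coact2X tlift_pure // -exprD line_coactX /tmap tlift_pure; last first.
  by have ltm := tlift_linear bm; lin.
by rewrite tlift_pure // -exprD.
Qed.

Lemma line_unit_morph : yd_morph (yd_unit D) line_yd (fun t : k^o => t%:A).
Proof.
have lu : linear (fun t : k^o => (t : k) *: (1 : A)).
  by apply: linear_scalel; exact: linear_id.
split=> [//|h t /=|t /=].
  by rewrite -(expr0 X) (linZ (bact.1 h)) line_actX scalerA mulrC.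
rewrite /tmap tlift_pure; last by lin.
rewrite (linZ lcoact) -(expr0 X) line_coactX !expr0.
by rewrite tpureZr.
Qed.

Lemma line_comul_morph : yd_morph line_yd (yd_tensor D line_yd line_yd) line_comul.
Proof.
split=> [//|h|].
  apply: (pow_ext hX (f := fun m => line_comul (line_act h m))
    (g := fun m => act2 h (line_comul m))) => [||n]; try lin.
  rewrite line_actX (linZ lcomul).
  apply: (tdeg_ext (F := fun t => (cpow n h : k) *: t)) => [||i j <-]; try lin.
  by rewrite act2X.
apply: (pow_ext hX (f := fun m => coact2 (line_comul m))
    (g := fun m => tmap id line_comul (line_coact m))) => [||n]; try lin.
rewrite line_coactX /tmap tlift_pure; last by lin.
apply: (tdeg_ext (G := fun t => g ^+ n ⊗ t)) => [||i j <-]; try lin.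
exact: coact2X.
Qed.

Lemma line_counit_morph : yd_morph line_yd (yd_unit D) line_counit.
Proof.
split=> [//|h|] /=.
  apply: (pow_ext hX (f := fun m => line_counit (line_act h m))
    (g := fun m => (counit D h : k) *: line_counit m)) => [||n]; try lin.
  rewrite line_actX (linZ lcounit) line_counitX.
  by case: eqP => [->|_]; rewrite ?scaler0.
apply: (pow_ext hX (f := fun m => 1 ⊗ line_counit m)
    (g := fun m => tmap id line_counit (line_coact m))) => [||n]; try lin.
rewrite line_coactX /tmap tlift_pure; last by lin.
rewrite line_counitX; case: eqP => [->|_]; first by rewrite expr0.
by rewrite !tpure0r.
Qed.

Lemma line_antip_morph : yd_morph line_yd line_yd line_antip.
Proof.
split=> [//|h|] /=.
  apply: (pow_ext hX (f := fun m => line_antip (line_act h m))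
    (g := fun m => line_act h (line_antip m))) => [||n]; try lin.
  rewrite line_actX line_antipX (linZ lantip) (linZ (bact.1 h)) line_actX line_antipX.
  by rewrite !scalerA mulrC.
apply: (pow_ext hX (f := fun m => line_coact (line_antip m))
    (g := fun m => tmap id line_antip (line_coact m))) => [||n]; try lin.
rewrite line_antipX (linZ lcoact) line_coactX /tmap tlift_pure; last by lin.
by rewrite line_antipX tpureZr.
Qed.

Lemma line_is_braided_hopf : is_braided_hopf D line_bh.
Proof.
split; first exact: line_is_yd.
split; split.
- exact: line_mul_morph.
- exact: line_unit_morph.
- exact: line_comul_morph.
- exact: line_counit_morph.
- exact: line_antip_morph.
- exact: line_is_coalgebra.
- by split; [exact: line_comul1|exact: line_comul_bmul].
- by split; [exact: line_counit1|exact: line_counitM].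
- exact: line_is_antipode.
Qed.

Lemma line_is_graded : is_graded_braided_hopf D line_bh (pow_gr X).
Proof.
split; first exact: line_is_braided_hopf.
split; first exact: pow_gr_direct.
split; split=> /=.
- move=> n h r [t ->]; exists (t * cpow n h).
  by rewrite (linZ (bact.1 h)) line_actX scalerA.
- move=> n r [t ->]; rewrite (linZ lcoact) line_coactX.
  rewrite -tpureZr.
  by apply: tspan_pure; exists t.
- by exists 1; rewrite scale1r.
- move=> m n r s [t ->] [u ->]; exists (t * u).
  by rewrite algZMl algZMr scalerA exprD.
- move=> n r [t ->]; rewrite (linZ lcomul).
  apply: (tspan_map (F := fun v => t *: v) _ _ (line_comul_tdeg n)); first by lin.
  move=> u v [i [j [ij gu [s ->]]]].
  rewrite -tpureZr; apply: tspan_pure.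
  by exists i, j; split=> //; exists (t * s); rewrite scalerA.
- move=> n r n0 [t ->]; rewrite (linZ lcounit) line_counitX.
  by case: n n0 => // n _; rewrite scaler0.
- move=> n r [t ->]; rewrite (linZ lantip) line_antipX; exists (t * (-1) ^+ n).
  by rewrite scalerA.
Qed.

Lemma line_is_nichols (V : lmodType k) (Y : yd_data H V) (i : V -> A) :
  (forall n, X ^+ n.+1 != 0 -> qint q n.+1 != 0) ->
  yd_iso_onto Y line_bh (pow_gr X 1) i -> is_nichols D Y line_bh (pow_gr X) i.
Proof.
move=> hqint hi; split=> //.
- exact: line_is_graded.
- exists (fun t : k^o => t%:A); split; first exact: line_unit_morph.
    move=> s t /eqP; rewrite -subr_eq0 -scalerBl scaler_eq0 oner_eq0 orbF subr_eq0.
    by move/eqP.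
  by move=> r; split=> [[t ->]|[t ->]]; exists t; rewrite expr0.
- move=> r /=; rewrite /pow_gr expr1.
  symmetry.
  apply: (primitive_degree1 hX X0 ls line_sigmaX line_is_coalgebra line_counitX
    line_comul1 line_comulM _ hqint).
move=> Q Q1 Q0 QD QM; apply: (pow_ind hX) => // n.
have QX : Q X by apply: Q1; exists 1; rewrite expr1 scale1r.
by elim: n => [|n IH]; rewrite ?expr0 ?exprS //; exact: QM.
Qed.

End Construction.

(** * An arbitrary Nichols algebra of a line *)

Section NicholsOfLine.
Variable k : fieldType.
Variables (H : algType k) (D : hopf_data H).
Variables (V : lmodType k) (Y : yd_data H V) (x : V) (chi : H -> k^o) (g : H).
Hypotheses (hg : grouplike D g) (x0 : x != 0) (hV : forall v, exists t : k, v = t *: x).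
Hypotheses (ax : forall h, act Y h x = (chi h : k) *: x) (cx : coact Y x = g ⊗ x).
Variables (R : algType k) (B : braided_hopf_data H R) (gr : nat -> R -> Prop).
Variables (iota : V -> R).
Hypothesis hB : is_nichols D Y B gr iota.
Local Notation y := (iota x).
Local Notation q := (chi g : k).

Let hBH : is_braided_hopf D B. Proof. by case: hB => -[]. Qed.
Let liota : linear iota. Proof. by case: hB => _ _ [[]]. Qed.
Let bact : bilin (act B). Proof. by case: hBH => -[[]]. Qed.
Let lcoact : linear (coact B). Proof. by case: hBH => -[_ []]. Qed.
Let hC : is_coalgebra (bcomul B) (bcounit B).
Proof. by case: hBH => _ [_ []]. Qed.
Let lcomul : linear (bcomul B). Proof. by case: hC. Qed.

Lemma nichols_generator_neq0 : y != 0.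
Proof.
have [_ inj _] : yd_iso_onto Y B (gr 1%N) iota by case: hB.
by apply: contra x0 => /eqP e; apply/eqP/inj; rewrite e (lin0 liota).
Qed.

Lemma nichols_gr1 r : gr 1%N r <-> exists t : k, r = t *: y.
Proof.
have [_ _ e] : yd_iso_onto Y B (gr 1%N) iota by case: hB.
rewrite e; split=> [[v ->]|[t ->]]; last by exists (t *: x); rewrite (linZ liota).
by have [t ->] := hV v; exists t; rewrite (linZ liota).
Qed.

Lemma nichols_gr_pow n : gr n (y ^+ n).
Proof.
have [_ [_ [[_ _ g0 gM] _]]] : is_graded_braided_hopf D B gr by case: hB.
elim: n => [|n IH]; first by rewrite expr0.
by rewrite exprS -add1n; apply: gM => //; apply/nichols_gr1; exists 1; rewrite scale1r.
Qed.

(** Spanning is generation in degree one; a relation between powers splits into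
    its homogeneous parts because the sum of the components is direct. *)
Lemma nichols_graded_generator : graded_generator y.
Proof.
have [_ [[gr0 grl _ dir] _]] : is_graded_braided_hopf D B gr by case: hB.
have lp := pcomb_linear (fun i => y ^+ i).
split=> [|p p0 i].
  have gen : generates (gr 1%N) by case: hB.
  apply: gen => [r /nichols_gr1[t ->]||t r s [a ->] [b ->]|r s [a ->] [b ->]].
  - by exists (t *: 'X^1); rewrite (linZ lp) pcombXn expr1.
  - by exists 'X^0; rewrite pcombXn expr0.
  - by exists (t *: a + b); rewrite lp.
  by exists (a * b); rewrite pcomb_powM.
case: (ltnP i (size p)) => [lti|]; last by move/(nth_default 0)->; rewrite scale0r.
apply: (dir (size p) (fun i => p`_i *: y ^+ i)) => // n.
by rewrite -[_ *: _]addr0; apply: grl; [exact: nichols_gr_pow|exact: gr0].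
Qed.

Lemma nichols_act_generator h : act B h y = (chi h : k) *: y.
Proof.
have [[_ e _] _ _] : yd_iso_onto Y B (gr 1%N) iota by case: hB.
by rewrite -e ax (linZ liota).
Qed.

Lemma nichols_coact_generator : coact B y = g ⊗ y.
Proof.
have [[_ _ e] _ _] : yd_iso_onto Y B (gr 1%N) iota by case: hB.
by rewrite e cx /tmap tlift_pure //; lin.
Qed.

Lemma nichols_coact1 : coact B 1 = 1 ⊗ 1.
Proof.
have [_ [[_ [_ _ e] _ _ _] _]] := hBH; have := e 1.
rewrite /= scale1r => ->; rewrite /tmap tlift_pure ?scale1r //.
have lu : linear (fun t : k^o => (t : k) *: (1 : R)).
  by apply: linear_scalel; exact: linear_id.
by lin.
Qed.

(** The product is a morphism, so the grouplike g acts by an algebra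
    automorphism. *)
Lemma nichols_act_pow n : act B g (y ^+ n) = q ^+ n *: y ^+ n.
Proof.
have [_ [[[_ eM _] [_ e1 _] _ _ _] _]] := hBH.
have bm : bilin (fun u v : R => u * v) by lin.
elim: n => [|n IH].
  by have := e1 g 1; rewrite /= hg.2 !scale1r !expr0 => <-.
have := eM g (y ⊗ y ^+ n).
rewrite tlift_pure // -exprS => <- /=; rewrite hg.1 tlift_pure; last by lin.
rewrite /tmap !tlift_pure; try lin.
by rewrite IH nichols_act_generator algZMl algZMr scalerA -!exprS.
Qed.

Lemma nichols_counit_pow n : bcounit B (y ^+ n) = (n == 0%N)%:R.
Proof.
have [_ [_ [_ _ [e1 _] _]]] := hBH.
have [_ [_ [_ [_ e _]]]] : is_graded_braided_hopf D B gr by case: hB.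
case: n => [|n]; first by rewrite expr0 e1.
by rewrite (e n.+1) //; exact: nichols_gr_pow.
Qed.

Lemma nichols_comul_generator : bcomul B y = y ⊗ 1 + 1 ⊗ y.
Proof.
have e : forall r, gr 1%N r <-> bcomul B r = r ⊗ 1 + 1 ⊗ r by case: hB.
by apply/e; rewrite -[y]expr1; exact: nichols_gr_pow.
Qed.

Lemma nichols_comulM r : bcomul B (y * r) = twist_mul y (act B g) (bcomul B r).
Proof.
have [_ [_ [_ [_ DM] _ _]]] := hBH.
have lbl := bmul_linearl bact lcoact; have lbr := bmul_linearr bact lcoact.
have ls : linear (act B g) := bact.1 g.
rewrite DM nichols_comul_generator (linD (lbl _)).
move: (bcomul B r); apply: tens_linear_ext => [||u v].
- exact: linear_add (lbr _) (lbr _).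
- exact: twist_mul_linear.
have bt (w z : R) : bilin (fun p s => (w * p) ⊗ (s * z)) by lin.
rewrite !bmul_pure // !braiding_pure // nichols_coact1 nichols_coact_generator.
have [[[_ a1 _] _ _] _] := hBH.
do ![rewrite tlift_pure; last by lin].
by rewrite a1 mul1r mul1r twist_mul_pure.
Qed.

Lemma nichols_comul1 : bcomul B 1 = 1 ⊗ 1.
Proof. by have [_ [_ [_ []]]] := hBH. Qed.

(** Descent by the skew derivation: y^(n+1) = 0 gives (n+1)_q y^n = 0, and so on
    down to y^0 = 1. *)
Lemma nichols_pow_neq0 : (forall n, qint q n.+1 != 0) -> forall n, y ^+ n != 0.
Proof.
move=> hq; elim=> [|n IH]; first by rewrite expr0 oner_eq0.
apply: contra IH => /eqP yn.
have e := skew_derX nichols_graded_generator nichols_generator_neq0 (bact.1 g)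
  nichols_act_pow hC  nichols_counit_pow nichols_comul1 nichols_comulM n.
have ld := skew_der_linear nichols_graded_generator nichols_generator_neq0 hC.
move: e; rewrite yn (lin0 ld) => /esym/eqP.
by rewrite scaler_eq0 (negbTE (hq n)).
Qed.

(** Delta(y^2) has mixed term (1 + q) y (x) y = 0, so y^2 is primitive, hence of
    degree one as well as of degree two. *)
Lemma nichols_sq0 : q = -1 -> y ^+ 2 = 0.
Proof.
move=> q1; have ls : linear (act B g) := bact.1 g.
have prim : bcomul B (y ^+ 2) = y ^+ 2 ⊗ 1 + 1 ⊗ y ^+ 2.
  have lt := twist_mul_linear y ls.
  rewrite expr2 nichols_comulM nichols_comul_generator (linD lt) !twist_mul_pure //.
  have e0 : act B g 1 = 1 by have := nichols_act_pow 0; rewrite !expr0 scale1r.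
  rewrite e0 nichols_act_generator q1 mulr1 scaleN1r.
  by rewrite tpureNl addrA subrK.
have e : forall r, gr 1%N r <-> bcomul B r = r ⊗ 1 + 1 ⊗ r by case: hB.
have [t yt] := (nichols_gr1 _).1 ((e _).2 prim).
have lp := pcomb_linear (fun i => y ^+ i).
have := nichols_graded_generator.2 ((- t) *: 'X^1 + 'X^2) _ 2%N.
rewrite lp !pcombXn expr1 yt scaleNr addNr => /(_ erefl).
by rewrite coefD coefZ !coefXn mulr0 add0r scale1r.
Qed.

End NicholsOfLine.

(** * Nichols algebras of one-dimensional Yetter-Drinfeld modules *)

Section Coordinate.
Variables (k : fieldType) (V : lmodType k) (x : V).
Hypotheses (x0 : x != 0) (hV : forall v, exists t : k, v = t *: x).

Definition coord_of (v : V) : k^o := projT1 (cid (hV v)).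

Lemma coord_ofE v : v = (coord_of v : k) *: x.
Proof. by rewrite /coord_of; case: cid. Qed.

Lemma coord_ofZ (t : k) : coord_of (t *: x) = t.
Proof.
apply/eqP; rewrite -subr_eq0; have /eqP := coord_ofE (t *: x).
by rewrite eq_sym -subr_eq0 -scalerBl scaler_eq0 (negbTE x0) orbF.
Qed.

Lemma coord_of_linear : linear coord_of.
Proof.
move=> t u v; rewrite [in LHS](coord_ofE u) [in LHS](coord_ofE v).
by rewrite scalerA -scalerDl coord_ofZ.
Qed.

Lemma coord_of1 : coord_of x = 1.
Proof. by rewrite -[x in LHS]scale1r coord_ofZ. Qed.

End Coordinate.

Section LineData.
Variable k : fieldType.
Variables (H : algType k) (D : hopf_data H).
Hypothesis hD : is_hopf D.
Variables (V : lmodType k) (Y : yd_data H V) (x : V) (g : H).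
Hypotheses (hY : is_yd D Y) (x0 : x != 0) (hV : forall v, exists t : k, v = t *: x).
Hypothesis cx : coact Y x = g ⊗ x.
Local Notation coord := (coord_of hV).

Definition line_char (h : H) : k^o := coord (act Y h x).

Let lcoord : linear coord. Proof. exact: coord_of_linear. Qed.
Let bact : bilin (act Y). Proof. by case: hY => -[]. Qed.
Let lcoact : linear (coact Y). Proof. by case: hY => _ []. Qed.
Let lDelta : linear (comul D). Proof. by case: hD => -[]. Qed.
Let lS : linear (antip D). Proof. by case: hD => _ _ _ []. Qed.
Let hDC : is_coalgebra (comul D) (counit D). Proof. by case: hD. Qed.

Lemma act_line_char h : act Y h x = (line_char h : k) *: x.
Proof. exact: coord_ofE. Qed.

Lemma line_char_linear : linear line_char.
Proof. rewrite /line_char; lin. Qed.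

Lemma line_char_character : character line_char.
Proof.
have [[_ a1 aM] _ _] := hY; split; first exact: line_char_linear.
  by rewrite /line_char a1 coord_of1.
move=> f h; rewrite /line_char aM (act_line_char h) (linZ (bact.1 f)).
by rewrite (act_line_char f) scalerA coord_ofZ // !coord_ofZ // mulrC.
Qed.

(** Coassociativity and counitality of the coaction, read on the coefficient
    of x. *)
Lemma line_grouplike : grouplike D g.
Proof.
have [_ [_ ca ce] _] := hY; split.
  have bP : bilin (fun h (t : H ⊗ V) => tlift (fun h' v => (coord v : k) *: (h ⊗ h')) t) by lin.
  have := congr1 (tlift (fun h t => tlift (fun h' v => (coord v : k) *: (h ⊗ h')) t)) (ca x).
  rewrite cx /tmap !tlift_pure; try lin.
  rewrite cx tlift_pure; last by lin.
  rewrite coord_of1 // scale1r => <-.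
  rewrite /tassoc tlift_pure; last by lin.
  move: (comul D g); apply: tens_linear_ext => [||u v]; try lin.
  rewrite !tlift_pure; try lin.
  by rewrite coord_of1 // scale1r.
have := ce x; rewrite cx tlift_pure; last first.
  have le : linear (counit D) by case: hD => -[].
  by lin.
by move/(congr1 coord); rewrite coord_ofZ // coord_of1.
Qed.

Lemma line_yd_pair : yd_pair D line_char g.
Proof.
apply: coact_yd_pair => [//||h]; first exact: line_char_linear.
have [_ _ e] := hY; have bP : bilin (fun (h : H) v => (coord v : k) *: h) by lin.
have := congr1 (tlift (fun (h : H) v => (coord v : k) *: h)) (e h x).
rewrite act_line_char (linZ lcoact) cx (linZ (tlift_linear bP)) tlift_pure //.
rewrite coord_of1 // scale1r => ->.
rewrite tlift_tmap; last by lin.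
rewrite (lin_tlift _ _ (tlift_linear bP)).
apply: eq_tlift => p z; rewrite (lin_tlift _ _ (tlift_linear bP)).
apply: eq_tlift => u v; rewrite tlift_pure; last by lin.
by rewrite tlift_pure // act_line_char coord_ofZ.
Qed.

Section Algebra.
Variables (A : algType k) (X : A).
Hypothesis hX : graded_generator X.
Hypothesis chark : [pchar k] =i pred0.
Local Notation q := (line_char g : k).
Hypothesis hqX : (q = 1 /\ forall n, X ^+ n != 0) \/ [/\ q = -1, X != 0 & X ^+ 2 = 0].

Definition line_embed (v : V) : A := (coord v : k) *: X.

Let hchi := line_char_character.
Let hg := line_grouplike.

Let X0 : X != 0.
Proof. by case: hqX => [[_ /(_ 1%N)]|[]]; rewrite ?expr1. Qed.

Lemma line_embed_iso :
  yd_iso_onto Y (line_bh D line_char g hX) (pow_gr X 1) line_embed.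
Proof.
have le : linear line_embed by rewrite /line_embed; lin.
have eZ t : line_embed (t *: x) = t *: X by rewrite /line_embed coord_ofZ.
split; first split=> //.
- move=> h v /=; rewrite {1}(coord_ofE hV v) (linZ (bact.1 h)) act_line_char scalerA eZ.
  rewrite /line_embed (linZ ((line_act_bilin hD hchi hX).1 h)).
  rewrite -[X in line_act _ _ _ _ X]expr1.
  rewrite line_actX scalerA expr1 conv_pow1 //; exact: line_char_linear.
- move=> v /=; rewrite [in RHS](coord_ofE hV v) (linZ lcoact) cx.
  have lt : linear (tmap (id : H -> H) line_embed) by lin.
  rewrite (linZ lt) /tmap tlift_pure; last by lin.
  rewrite {2}/line_embed coord_of1 // scale1r.
  rewrite /line_embed (linZ (line_coact_linear g hX)) -[X in line_coact _ _ X]expr1.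
  by rewrite line_coactX !expr1.
- move=> u v /eqP; rewrite /line_embed -subr_eq0 -scalerBl scaler_eq0 (negbTE X0) orbF.
  by rewrite subr_eq0 => /eqP e; rewrite (coord_ofE hV u) e -coord_ofE.
move=> r; split=> [[t ->]|[v ->]]; last by exists (coord v); rewrite expr1.
by exists (t *: x); rewrite eZ expr1.
Qed.

(** Any Nichols algebra has the same vanishing powers of its generator as A, and
    this set of exponents determines an algebra with homogeneous relations. *)
Lemma line_nichols_algebra_is : nichols_algebra_is D Y line_embed.
Proof.
split.
  exists (line_bh D line_char g hX), (pow_gr X).
  apply: (line_is_nichols hD hchi hg line_yd_pair) => //; last exact: line_embed_iso.
  - move=> n Xn; case: hqX => [[_ /(_ n)]|[q1 _ X2]]; first by rewrite Xn eqxx.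
    move/eqP: Xn; rewrite (sq0_pow _ X0 X2); case: n => [|[|n]] // _.
    have TX := ThetaX hD hchi hg hX; set T := twist_mul _ _ in TX *.
    have lT : linear T.
      by apply: twist_mul_linear; exact: (line_act_bilin hD hchi hX).1.
    rewrite -addn2 iterD /=.
    have -> : T (T (1 ⊗ 1)) = 0.
      have := TX 0%N 0%N; rewrite !expr0 scale1r => ->.
      rewrite (linD lT); have := TX 1%N 0%N; rewrite expr0 => ->.
      have := TX 0%N 1%N; rewrite expr0 scale1r => ->.
      rewrite X2 q1 expr1 scaleN1r addrA subrK.
      by rewrite tpure0l tpure0r addr0.
    by elim: n => //= n ->; exact: lin0 lT.
  - by case: hqX => [[-> _]|[_ _ ->]]; rewrite ?scale1r ?scaler0.
  - move=> n; case: hqX => [[-> _] _|[_ _ X2]]; first exact: qint1_neq0.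
    rewrite (sq0_pow _ X0 X2); case: n => // _.
    by rewrite /qint big_ord1 expr0 oner_neq0.
move=> R B gr iota hB.
have liota : linear iota by case: hB => _ _ [[]].
have y0 := nichols_generator_neq0 x0 hB.
have hy := nichols_graded_generator hV hB.
have ypow n : (X ^+ n == 0) = (iota x ^+ n == 0).
  case: hqX => [[q1 Xn]|[q1 _ X2]].
    rewrite (negbTE (Xn n)); apply/esym/negbTE.
    apply: (nichols_pow_neq0 hg x0 hV act_line_char cx hB) => m.
    by rewrite q1; exact: qint1_neq0.
  by rewrite !sq0_pow //; exact: (nichols_sq0 hg hV act_line_char cx hB).
have [|phi phiX] := pow_morphism hX (y := iota x).
  by move=> n /eqP; rewrite ypow => /eqP.
exists phi; split.
  apply: (pow_morphism_bij hX hy _ phiX) => n /eqP.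
  by rewrite -ypow => /eqP.
have lphi : linear (phi : A -> R) := linearP phi.
by move=> v; rewrite /line_embed (linZ lphi) phiX [in RHS](coord_ofE hV v) (linZ liota).
Qed.

End Algebra.
End LineData.

(** An algebra map out of A is the choice of an element of square zero, the
    image of X. *)
Lemma line_exterior (k : fieldType) (V : lmodType k) (x : V)
    (hV : forall v, exists t : k, v = t *: x) (x0 : x != 0)
    (A : algType k) (X : A) : graded_generator X -> X != 0 -> X ^+ 2 = 0 ->
  is_exterior_algebra (line_embed hV X).
Proof.
move=> hX X0 X2; have lc := coord_of_linear x0 hV.
split=> [|v|B f lf f2].
- by rewrite /line_embed; lin.
- by rewrite expr2 algZMl algZMr -expr2 X2 !scaler0.
have [|phi phiX] := pow_morphism hX (y := f x).
  move=> n /eqP; rewrite (sq0_pow _ X0 X2); case: n => [|[|n]] // _.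
  by rewrite -addn2 exprD f2 mulr0.
have lphi : linear (phi : A -> B) := linearP phi.
exists phi; split=> [v|psi psiE].
  by rewrite /line_embed (linZ lphi) phiX [in RHS](coord_ofE hV v) (linZ lf).
apply: (pow_ext hX) => [||n]; try exact: linearP.
by rewrite !rmorphXn /= phiX -psiE /line_embed coord_of1 // scale1r.
Qed.

Theorem lemma4p1 (k : closedFieldType) (chark : [pchar k] =i pred0)
    (xi : k) (hxi : 4.-primitive_root xi)
    (K : falgType k) (D : hopf_data K) (a b c d : K) (hK : is_K xi D a b c d)
    (j : nat) (hj : (j <= 3)%N)
    (V : lmodType k) (Y : yd_data K V) (x : V)
    (hV : is_k_chi xi D a b c d j Y x) :
  ((j = 0 \/ j = 2)%N ->
     exists i : V -> {poly k}, i x = 'X /\ nichols_algebra_is D Y i) /\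
  ((j = 1 \/ j = 3)%N ->
     exists i : V -> {poly %/ ('X^2 : {poly k})},
       [/\ i x = 'qX, nichols_algebra_is D Y i & is_exterior_algebra i]).
Proof.
have hD : is_hopf D by case: hK => -[].
have [[hY x0 hx] [[ax _ _ _] cx]] := hV.
have [lc c1 cM] := line_char_character hY x0 hx.
set chi := line_char Y hx in lc c1 cM.
(* The braiding scalar q is chi(g) with g = a^(2j). *)
have q : chi (a ^+ (2 * j)) = xi ^+ (j * (2 * j)).
  have ca : chi a = xi ^+ j by rewrite /chi /line_char ax coord_ofZ.
  rewrite [RHS]exprM -ca; elim: (2 * j)%N => [|n IH]; first by rewrite !expr0.
  by rewrite !exprS cM IH.
have xi4 : xi ^+ 4 = 1 := prim_expr_order hxi.
have xi2 : xi ^+ 2 = -1.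
  have : xi ^+ 2 != 1 by rewrite -(prim_order_dvd hxi).
  move=> /negbTE ne; have /eqP := xi4.
  by rewrite (exprM xi 2 2) sqrf_eq1 ne => /eqP.
split=> hj'.
  exists (line_embed hx 'X); rewrite {1}/line_embed coord_of1 // scale1r.
  split=> //; apply: (line_nichols_algebra_is hD hY x0 cx (graded_generator_polyX k) chark).
  left; split=> [|n]; last by rewrite -size_poly_eq0 size_polyXn.
  rewrite [LHS]q; case: hj' => ->; first by rewrite muln0 expr0.
  by rewrite (exprM xi 4 2) xi4 expr1n.
have X0 : 'qX != 0 :> {poly %/ ('X^2 : {poly k})}.
  by rewrite -[X in X != _]expr1 qpolyX2_powE.
have X2 : ('qX : {poly %/ ('X^2 : {poly k})}) ^+ 2 = 0.
  by apply/eqP; rewrite qpolyX2_powE.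
have hX := graded_generator_qpolyX k.
exists (line_embed hx 'qX); split; last exact: line_exterior.
  by rewrite /line_embed coord_of1 // scale1r.
apply: (line_nichols_algebra_is hD hY x0 cx hX chark).
right; split=> //; rewrite [LHS]q; case: hj' => ->; first by [].
by rewrite (exprD xi 16 2) (exprM xi 4 4) xi4 expr1n mul1r.
Qed.
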